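(* Let $X$ be an infinite compact Hausdorff space, let $g$ be a homeomorphism of $X$ and let $G$ be a virtually polycyclic subgroup of $\tau[g]$. If $g$ admits a minimal-periodic partition, then so does $G$. Moreover, if $g$ admits a minimal-periodic partition, then for each closed $G$-minimal subspace $Y$ of $X$ there is a normal subgroup $N$ of $G$ and a partition of $Y$ into finitely many clopen $N$-minimal spaces $Y_1,\dots,Y_n$, such that, writing $N_i$ for the kernel of the action of $N$ on $Y_i$, we have $N/N_i\cong\mathbb{Z}$.
   Context: For a homeomorphism $g$ of $X$, the topological full group $\tau[g]$ is the group of all homeomorphisms $h$ of $X$ for which there is a locally constant function $c:X\to\langle g\rangle$ with $hx=c(x)x$ for all $x\in X$, where $\langle g\rangle=\{g^n\mid n\in\mathbb{Z}\}$. A group is polycyclic if it admits a subnormal series with finitely many factors, each of which is cyclic; it is virtually polycyclic if it has a polycyclic subgroup of finite index. For a group $G$ of homeomorphisms of a compact Hausdorff space $X$, a subset $Y\subseteq X$ is $G$-invariant if $gY=Y$ for all $g\in G$; it is $G$-minimal (or $G$ acts minimally on $Y$) if $Y$ is nonempty, $G$-invariant, and the only proper closed $G$-invariant subset of $Y$ is the empty set. $G$ is strongly periodic on $X$ if there are finitely many distinct subgroups $K_1,\dots,K_n$ of $G$ of finite index such that for each $1\le j\le n$ the set $X_{\mathrm{per}}(j)$ of points with stabilizer conjugate to $K_j$ is clopen, and $X=\bigsqcup_{j=1}^n X_{\mathrm{per}}(j)$. Equivalently: $G$ acts with kernel of finite index and for every $h\in G$ the set of fixed points of $h$ on $X$ is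 clopen. $G$ admits a minimal-periodic partition if there is a partition of $X$ into clopen $G$-invariant subspaces $X=\bigsqcup_{i=1}^m X_{\mathrm{aper}}(i)\sqcup X_{\mathrm{per}}$, where $G$ acts minimally on each of the infinite subspaces $X_{\mathrm{aper}}(1),\dots,X_{\mathrm{aper}}(m)$, and has strongly periodic action on $X_{\mathrm{per}}$ (the union of the finite $G$-orbits). A single homeomorphism $h$ admits a minimal-periodic partition if the group $\langle h\rangle$ does.
   Formalization: The isomorphism N/N_i ≅ Z is asserted only when Y is infinite; for finite Y it is impossible, since N/N_i acts faithfully on a finite set (e.g. G trivial, Y a point). For finite Y only N and the partition into clopen N-minimal spaces are claimed. *)

(* Defs.v *)
From HB Require Import structures.
From mathcomp Require Import all_boot all_order all_algebra.
From mathcomp Require Import all_classical all_reals all_analysis.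

Set Implicit Arguments.
Unset Strict Implicit.
Unset Printing Implicit Defensive.

Local Open Scope classical_set_scope.
Local Open Scope group_scope.

(* Subgroups of a possibly infinite group are represented by classical sets. *)
Section Groups.
Context {gT : groupType}.
Implicit Types (x a : gT) (A B H K : set gT).

Definition subgroup H :=
  [/\ H 1, forall x y, H x -> H y -> H (x * y) & forall x, H x -> H x^-1].

Definition zpow x (k : int) : gT :=
  match k with Posz n => x ^+ n | Negz n => x ^- n.+1 end.

Definition cyclic_group x : set gT := [set zpow x k | k in [set: int]].

Definition conj_set K a : set gT := [set k ^ a | k in K].

Definition normal_subgroup K H :=
  [/\ subgroup K, subgroup H, K `<=` H & forall a, H a -> conj_set K a `<=` K].

Definition mul_set A B : set gT := [set x * y | x in A & y in B].

Definition left_coset x K : set gT := [set x * k | k in K].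

(* For K normal in H, this is the underlying set of the quotient group H/K,
   whose group law is mul_set. *)
Definition cosets H K : set (set gT) := [set left_coset x K | x in H].

(* (zpow a k)K is the k-th power of aK in H/K when K is normal in H. *)
Definition cyclic_quotient H K :=
  exists2 a, H a & cosets H K = [set left_coset (zpow a k) K | k in [set: int]].

Definition quotient_isog_int H K :=
  normal_subgroup K H /\
  exists f : set gT -> int,
    set_bij (cosets H K) [set: int] f /\
    (forall A B, cosets H K A -> cosets H K B ->
       f (mul_set A B) = (f A + f B)%R).

Definition finite_index_subgroup K H :=
  [/\ subgroup K, subgroup H, K `<=` H & finite_set (cosets H K)].

Definition polycyclic H :=
  exists (r : nat) (S : nat -> set gT),
    [/\ S 0%N = [set 1], S r = H &
        forall i, (i < r)%N ->
          normal_subgroup (S i) (S i.+1) /\ cyclic_quotient (S i.+1) (S i)].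

Definition virtually_polycyclic H :=
  exists2 K, finite_index_subgroup K H & polycyclic K.

End Groups.

(* The inverse is stored as data; it is determined by the function, so equality
   of homeomorphisms is pointwise (homeo_ext). *)
Record homeo (X : topologicalType) := Homeo {
  homeo_fun :> X -> X;
  homeo_inv : X -> X;
  homeo_funK : cancel homeo_fun homeo_inv;
  homeo_invK : cancel homeo_inv homeo_fun;
  homeo_fun_continuous : continuous homeo_fun;
  homeo_inv_continuous : continuous homeo_inv }.

Section HomeoGroup.
Context {X : topologicalType}.
Implicit Types f g h : homeo X.

Lemma homeo_ext f g : f =1 g -> f = g.
Proof.
case: f => f f' fK f'K fc f'c; case: g => g g' gK g'K gc g'c /= fg.
have {}fg : f = g by exact: funext.
subst g; have f'g' : f' = g' by apply: funext => x; rewrite -{1}(g'K x) fK.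
by subst g'; congr Homeo; exact: Prop_irrelevance.
Qed.

Definition homeo_one : homeo X :=
  @Homeo X id id (fun=> erefl) (fun=> erefl)
    (fun=> cvg_id) (fun=> cvg_id).

Definition homeo_mul f g : homeo X :=
  @Homeo X (f \o g) (homeo_inv g \o homeo_inv f)
    (can_comp (homeo_funK f) (homeo_funK g))
    (can_comp (homeo_invK g) (homeo_invK f))
    (fun x => continuous_comp (@homeo_fun_continuous X g x)
                              (@homeo_fun_continuous X f (g x)))
    (fun x => continuous_comp (@homeo_inv_continuous X f x)
                              (@homeo_inv_continuous X g (homeo_inv f x))).

Definition homeo_inverse f : homeo X :=
  @Homeo X (homeo_inv f) f (homeo_invK f) (homeo_funK f)
    (@homeo_inv_continuous X f) (@homeo_fun_continuous X f).

Lemma homeo_mulA : associative homeo_mul.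
Proof. by move=> f g h; exact: homeo_ext. Qed.

Lemma homeo_mul1 : left_id homeo_one homeo_mul.
Proof. by move=> f; exact: homeo_ext. Qed.

Lemma homeo_mulr1 : right_id homeo_one homeo_mul.
Proof. by move=> f; exact: homeo_ext. Qed.

Lemma homeo_mulV : left_inverse homeo_one homeo_inverse homeo_mul.
Proof. by move=> f; apply: homeo_ext => x /=; rewrite homeo_funK. Qed.

Lemma homeo_mulrV : right_inverse homeo_one homeo_inverse homeo_mul.
Proof. by move=> f; apply: homeo_ext => x /=; rewrite homeo_invK. Qed.

HB.instance Definition _ := gen_eqMixin (homeo X).
HB.instance Definition _ := gen_choiceMixin (homeo X).
HB.instance Definition _ := isGroup.Build (homeo X)
  homeo_mulA homeo_mul1 homeo_mulr1 homeo_mulV homeo_mulrV.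

End HomeoGroup.

Section Dynamics.
Context {X : topologicalType}.
Implicit Types (g h : homeo X) (G N K : set (homeo X)) (Y A C : set X).

Definition topological_full_group g : set (homeo X) :=
  [set h | exists c : X -> homeo X,
    [/\ forall x, cyclic_group g (c x),
        forall x, \forall y \near x, c y = c x &
        forall x, h x = c x x]].

Definition group_invariant G Y := forall h, G h -> h @` Y = Y.

Definition minimal G Y :=
  [/\ Y !=set0, group_invariant G Y &
      forall C, closed C -> C `<=` Y -> group_invariant G C -> C = set0 \/ C = Y].

Definition orbit G (x : X) : set X := [set h x | h in G].

Definition stabilizer G (x : X) : set (homeo X) := [set h | G h /\ h x = x].

Definition pointwise_stabilizer G Y : set (homeo X) :=
  [set h | G h /\ forall y, Y y -> h y = y].

Definition clopen_in Y A := A `<=` Y /\ @clopen (subspace Y) A.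

Definition clopen_partition_in Y n (Z : 'I_n -> set X) :=
  [/\ forall i, clopen_in Y (Z i), trivIset [set: 'I_n] Z &
      \bigcup_(i in [set: 'I_n]) Z i = Y].

Definition conj_stabilizer_part G Y K : set X :=
  [set x | Y x /\ exists2 a, G a & stabilizer G x = conj_set K a].

Definition strongly_periodic G Y :=
  exists (n : nat) (K : 'I_n -> set (homeo X)),
    [/\ injective K,
        forall j, finite_index_subgroup (K j) G &
        clopen_partition_in Y (fun j => conj_stabilizer_part G Y (K j))].

Definition periodic_part G : set X := [set x | finite_set (orbit G x)].

Definition minimal_periodic_partition G :=
  exists (m : nat) (A : 'I_m -> set X),
    [/\ forall i, [/\ clopen (A i), infinite_set (A i) & minimal G (A i)],
        clopen (periodic_part G) /\ group_invariant G (periodic_part G),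
        trivIset [set: 'I_m] A /\
          (forall i, A i `&` periodic_part G = set0),
        \bigcup_(i in [set: 'I_m]) A i `|` periodic_part G = [set: X] &
        strongly_periodic G (periodic_part G)].

End Dynamics.

(* Main.v *)
(** Every g-orbit that is infinite lies in a minimal set on which g acts freely,
    and there an element of the full group moves points by boundedly many steps
    of g.  Hence an infinite orbit of a finitely generated group G inside the
    full group meets every long enough stretch of a half g-orbit, so finitely
    many g-translates of an infinite closed G-minimal set cover a g-minimal set;
    by Baire such a set has interior points and is therefore clopen.  Elements
    fixing a point fix a neighbourhood of it, so the stabilizers of points with
    finite orbit are locally constant.  The partition follows by compactness.

    For the second part, a derived series made of normal subgroups of G provides
    a normal subgroup A with infinite orbits on Y whose derived subgroup acts on
    Y through a finite group; the elements of A that commute with A on Y then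
    have finite index in A, and so also have infinite orbits.  This abelian
    group acts freely, modulo the kernel, on each of its minimal pieces.  Since
    only boundedly many infinite orbits of a single element fit into a g-orbit,
    it is virtually cyclic there, and N consists of M-th powers for a suitable
    M. *)

Require Import Defs.
From HB Require Import structures.
From mathcomp Require Import all_boot all_order all_algebra.
From mathcomp Require Import all_classical all_reals all_analysis.
From mathcomp Require Import zify.

Local Open Scope classical_set_scope.

(** * Finitely generated and polycyclic groups *)

Section FiniteImages.
Set Implicit Arguments.
Unset Strict Implicit.

(** On [A] the map [h] factors through [f]; the factor map is [h] composed with a choice of
    preimages under [f]. *)
Lemma finite_image_factor (T U V : Type) (A : set T) (f : T -> U) (h : T -> V) :
    finite_set (f @` A) ->
    (forall a a', A a -> A a' -> f a = f a' -> h a = h a') ->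
  finite_set (h @` A).
Proof.
move=> fin fh.
have [->|/set0P[a0 Aa0]] := eqVneq A set0; first by rewrite image_set0.
pose r u := if pselect (exists2 a, A a & f a = u) is left e
            then sval (cid2 e) else a0.
apply: (@sub_finite_set _ _ ((h \o r) @` (f @` A))); last exact: finite_image.
move=> _ [a Aa <-]; exists (f a); first by exists a.
rewrite /= /r; case: pselect => [e|[]]; last by exists a.
by case: cid2 => a' Aa' faa' /=; apply: fh.
Qed.

Lemma finite_image_tuple (T I U : Type) (A : set T) (s : seq I)
    (f : I -> T -> U) :
    (forall i, List.In i s -> finite_set (f i @` A)) ->
  finite_set ((fun a => [seq f i a | i <- s]) @` A).
Proof.
elim: s => [|i s IHs] fin.
  by apply: sub_finite_set (finite_set1 [::]) => _ [a _ <-].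
have fi := fin i (or_introl erefl).
have fs := IHs (fun j sj => fin j (or_intror sj)).
apply: sub_finite_set (finite_image2 cons fi fs) => _ [a Aa <-] /=.
by exists (f i a); [exists a|exists [seq f j a | j <- s]; first by exists a].
Qed.

Lemma eq_map_In (T I U : Type) (s : seq I) (f : I -> T -> U) a a' :
  [seq f i a | i <- s] = [seq f i a' | i <- s] ->
  forall i, List.In i s -> f i a = f i a'.
Proof. by elim: s => //= j s IHs [e /IHs h] i [<-//|/h]. Qed.

(** [List.In] needs no equality test, so points, sets and homeomorphisms can all be enumerated in
    this way. *)
Lemma finite_set_List (T : Type) (A : set T) :
  finite_set A -> exists s : seq T, forall x, A x <-> List.In x s.
Proof.
elim/Pchoice: T => T in A *.
move=> /finite_seqP[s ->]; exists s => x /=.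
elim: s => //= y s IHs; rewrite inE; split.
  by move=> /orP[/eqP->|/IHs]; [left|right].
by move=> [->|/IHs ->]; rewrite ?eqxx ?orbT.
Qed.

Lemma finite_set_enum (T : Type) (A : set T) : finite_set A ->
  exists (n : nat) (F : 'I_n -> T),
    injective F /\ forall x, A x <-> exists i, F i = x.
Proof.
elim/Pchoice: T => T in A *; move=> /finite_seqP[s ->].
exists (size (undup s)), (tnth (in_tuple (undup s))); split.
  by apply/tuple_uniqP; apply: undup_uniq.
move=> x /=; rewrite -mem_undup.
by split=> [/(@tnthP _ _ (in_tuple _))|] [i e]; [exists i|rewrite -e mem_tnth].
Qed.

End FiniteImages.

Section Groups.
Set Implicit Arguments.
Unset Strict Implicit.
Local Open Scope group_scope.
Context {gT : groupType}.
Implicit Types (x a : gT) (A B H K : set gT).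

Lemma subgroupX H x n : subgroup H -> H x -> H (x ^+ n).
Proof.
by move=> [H1 HM _] Hx; elim: n => // n IHn; rewrite expgS; apply: HM.
Qed.

Lemma subgroupZ H x k : subgroup H -> H x -> H (zpow x k).
Proof.
move=> sH Hx; case: k => n /=; first exact: subgroupX.
by have [_ _ HV] := sH; apply: HV; exact: subgroupX.
Qed.

Lemma subgroupJ H x a : subgroup H -> H x -> H a -> H (x ^ a).
Proof. by move=> [_ HM HV] Hx Ha; rewrite conjgE; apply: HM (HM _ _ _ _); auto. Qed.

Lemma subgroupI H K : subgroup H -> subgroup K -> subgroup (H `&` K).
Proof.
move=> [H1 HM HV] [K1 KM KV]; split=> [//|x y [Hx Kx] [Hy Ky]|x [Hx Kx]].
  by split; [apply: HM|apply: KM].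
by split; [apply: HV|apply: KV].
Qed.

Lemma subgroup1 : subgroup [set 1 : gT].
Proof. by split=> [//|x y -> ->|x ->]; rewrite /= ?mulg1 ?invg1. Qed.

Lemma zpowS x k : zpow x (k + 1)%R = zpow x k * x.
Proof.
case: k => [n|[|n]]; first by rewrite -PoszD addn1 /= expgSr.
  by rewrite NegzE GRing.addNr /= expg1 mulVg.
rewrite [LHS](_ : _ = zpow x (Negz n)); last by congr zpow; lia.
by rewrite /= [x ^+ n.+2]expgS invgM mulgVK.
Qed.

Lemma zpowD x k l : zpow x (k + l)%R = zpow x k * zpow x l.
Proof.
elim/int_ind: l => [|n IHn|n IHn]; first by rewrite GRing.addr0 /= mulg1.
  by rewrite -addn1 PoszD GRing.addrA !zpowS IHn mulgA.
apply: (mulIg x); rewrite -mulgA -!zpowS.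
by rewrite (_ : (- (n.+1%:Z) + 1 = - (n%:Z))%R) -?IHn; [congr zpow|]; lia.
Qed.

Lemma zpowN x k : zpow x (- k)%R = (zpow x k)^-1.
Proof. by apply: (mulIg (zpow x k)); rewrite -zpowD GRing.addNr mulVg. Qed.

Lemma zpowC x k l : zpow x k * zpow x l = zpow x l * zpow x k.
Proof. by rewrite -!zpowD GRing.addrC. Qed.

Lemma zpowM x k l : zpow x (k * l)%R = zpow (zpow x k) l.
Proof.
elim/int_ind: l => [|n IHn|n IHn]; first by rewrite GRing.mulr0.
  by rewrite -addn1 PoszD GRing.mulrDr GRing.mulr1 [LHS]zpowD IHn [RHS]zpowS.
apply: (mulIg (zpow x k)); rewrite -(zpowS (zpow x k)) -zpowD.
by rewrite (_ : (- n.+1%:Z + 1)%R = (- n%:Z)%R) -?IHn; [congr zpow|]; lia.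
Qed.

Lemma subgroup_cyclic x : subgroup (cyclic_group x).
Proof.
split; first by exists 0%R.
  by move=> _ _ [k _ <-] [l _ <-]; exists (k + l)%R; rewrite // zpowD.
by move=> _ [k _ <-]; exists (- k)%R; rewrite // zpowN.
Qed.

(** Generation is phrased through subgroups instead of words: a property is carried from the
    generators to [H] by checking that the elements having it form a subgroup. *)
Definition finitely_generated H :=
  exists2 s : seq gT, (forall x, List.In x s -> H x) &
    forall K, subgroup K -> (forall x, List.In x s -> K x) -> H `<=` K.

Lemma fg_cyclic x : finitely_generated (cyclic_group x).
Proof.
exists [:: x] => [y [<-|//]|K sK Kx y [k _ <-]]; first by exists 1%R.
by apply: subgroupZ => //; apply: Kx; left.
Qed.

Lemma left_coset_eqP H a b : subgroup H ->
  left_coset a H = left_coset b H <-> H (a^-1 * b).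
Proof.
move=> [H1 HM HV]; split=> [e|Hab].
  have : left_coset b H b by exists 1; rewrite ?mulg1.
  by rewrite -e => -[k Hk <-]; rewrite mulKg.
apply/seteqP; split=> _ [k Hk <-].
  exists ((a^-1 * b)^-1 * k); first by apply: HM => //; apply: HV.
  by rewrite invgM invgK !mulgA mulgV mul1g.
by exists (a^-1 * b * k); [apply: HM|rewrite !mulgA mulgV mul1g].
Qed.

Lemma finite_cosetsI A (U : Type) (f : gT -> U) K :
    subgroup K -> finite_set (f @` A) ->
    (forall a b, A a -> A b -> f a = f b -> K (a^-1 * b)) ->
  finite_set (cosets A K).
Proof.
move=> sK fin fK; apply: finite_image_factor fin _ => a b Aa Ab e.
exact/left_coset_eqP/fK.
Qed.

Lemma finite_cosets_transversal A K : subgroup K -> finite_set (cosets A K) ->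
  exists2 s : seq gT, (forall t, List.In t s -> A t) &
    forall a, A a -> exists2 t, List.In t s & K (t^-1 * a).
Proof.
move=> sK fin.
pose r c := if pselect (exists2 a, A a & left_coset a K = c) is left e
            then sval (cid2 e) else 1.
have rP a : A a -> A (r (left_coset a K)) /\
    left_coset (r (left_coset a K)) K = left_coset a K.
  by move=> Aa; rewrite /r; case: pselect => [e|[]];
    [case: cid2|exists a].
have /finite_set_List[s sP] := finite_image r fin.
exists s => [t /sP[_ [a Aa <-] <-]|a Aa]; first by have [] := rP _ Aa.
have [_ e] := rP _ Aa; exists (r (left_coset a K)).
  by apply/sP; exists (left_coset a K) => //; exists a.
exact/left_coset_eqP.
Qed.

(** Coset representatives of [K] together with generators of [K] generate [H]. *)
Lemma fg_finite_index K H : finite_index_subgroup K H ->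
  finitely_generated K -> finitely_generated H.
Proof.
move=> [sK sH KH fin] [s sK' sP].
have [t tH tP] := finite_cosets_transversal sK fin.
exists (t ++ s) => [x /List.in_app_iff[/tH//|/sK'/KH//]|L sL Ls x Hx].
have [u ut Kux] := tP _ Hx.
have Lu : L u by apply: Ls; apply/List.in_app_iff; left.
have Lux : L (u^-1 * x).
  apply: sP Kux => // y sy; apply: Ls; apply/List.in_app_iff; right.
  exact: sy.
by rewrite -(mulVKg u x); have [_ LM _] := sL; apply: LM.
Qed.

(** Division with remainder by the least positive element, which is sought in the form [n.+1] to
    minimise over [nat]; the zero subgroup gives [d = 0]. *)
Lemma int_subgroup_generator (D : set int) :
    D 0%R -> (forall k l, D k -> D l -> D (k + l)%R) ->
    (forall k, D k -> D (- k)%R) ->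
  exists2 d : int, D d & forall k, D k -> exists l : int, k = (d * l)%R.
Proof.
move=> D0 DD DN.
have DM k l : D k -> D (k * l)%R.
  move=> Dk; elim/int_ind: l => [|n IHn|n IHn]; first by rewrite GRing.mulr0.
    by rewrite -addn1 PoszD GRing.mulrDr GRing.mulr1; apply: DD.
  have -> : (k * - n.+1%:Z = k * - n%:Z - k)%R by lia.
  by apply: DD => //; apply: DN.
have [[k [Dk k0]]|D0'] := pselect (exists k, D k /\ k != 0%R); last first.
  exists 0%R => // k Dk; exists 0%R; apply/eqP; rewrite GRing.mulr0.
  by apply: contra_notT D0' => k0; exists k.
have ex : exists n, `[< D (Posz n.+1) >].
  have [k_gt0|k_lt0] := boolP (0 < k)%R.
    by exists `|k|.-1; apply/asboolP; rewrite (_ : Posz _ = k)//; lia.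
  exists `|k|.-1; apply/asboolP; rewrite (_ : Posz _ = - k)%R; last by lia.
  exact: DN.
have [n /asboolP Dn n_min] := ex_minnP ex.
exists (Posz n.+1) => // l Dl; exists (l %/ Posz n.+1)%Z.
have eq_l := divz_eq l (Posz n.+1).
set q := (l %/ _)%Z in eq_l *; set r := (l %% _)%Z in eq_l.
have Dr : D r.
  rewrite (_ : r = l + Posz n.+1 * - q)%R; first by apply: DD => //; apply: DM.
  by rewrite eq_l; lia.
have r0 : (0 <= r)%R by apply: modz_ge0.
have rn : (r < Posz n.+1)%R by apply: ltz_pmod.
have [r_eq0|rN0] := eqVneq r 0%R; first by rewrite eq_l r_eq0; lia.
have /n_min : `[< D (Posz `|r|.-1.+1) >].
  by apply/asboolP; rewrite (_ : Posz _ = r)//; lia.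
by lia.
Qed.

Lemma normalJ K H x a : normal_subgroup K H -> K x -> H a -> K (x ^ a).
Proof. by move=> [_ _ _ nK] Kx Ha; apply: (nK a Ha); exists x. Qed.

(** Congruence modulo [K] is written [K (x^-1 * y)]. This lemma and the next two allow computing
    with it as in the quotient group. *)
Lemma coset_congM K H x y x' y' : normal_subgroup K H ->
    H x' -> K (x^-1 * y) -> K (x'^-1 * y') ->
  K ((x * x')^-1 * (y * y')).
Proof.
move=> nK Hx' Kxy Kxy'; have [[_ KM _] _ _ _] := nK.
rewrite (_ : _ * _ = (x^-1 * y) ^ x' * (x'^-1 * y')).
  by apply: KM => //; apply: normalJ nK _ _.
by rewrite conjgE invgM !mulgA mulgK.
Qed.

Lemma coset_congV K H x y : normal_subgroup K H ->
  H x -> K (x^-1 * y) -> K (x^-1^-1 * y^-1).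
Proof.
move=> nK Hx Kxy; have [[_ _ KV] [_ _ HV] _ _] := nK.
rewrite (_ : _ * _ = (x^-1 * y)^-1 ^ (x^-1)).
  by apply: normalJ nK (KV _ Kxy) (HV _ Hx).
by rewrite conjgE !invgM !invgK !mulgA mulgK.
Qed.

Lemma coset_congZ K H x y k : normal_subgroup K H ->
  H x -> K (x^-1 * y) -> K ((zpow x k)^-1 * zpow y k).
Proof.
move=> nK Hx Kxy; have [[K1 _ _] sH _ _] := nK.
have [_ _ HV] := sH.
elim/int_ind: k => [|n IHn|n IHn]; first by rewrite /= invg1 mulg1.
  by rewrite -addn1 PoszD !zpowS; apply: (coset_congM nK).
rewrite (_ : (- n.+1%:Z = - n%:Z + - 1%:Z)%R); last by lia.
rewrite (zpowD x) (zpowD y); apply: (coset_congM nK) => //.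
  exact: subgroupZ.
by rewrite !zpowN; apply: (coset_congV nK).
Qed.

(** The exponents [k] for which the coset of [zpow a k] meets the intersection of [L] and [H] form a
    subgroup of the integers. An element over a generator of that subgroup is the only generator to
    be added. *)
Lemma fg_polycyclic_step K H L :
    normal_subgroup K H -> cyclic_quotient H K -> subgroup L ->
    finitely_generated (L `&` K) ->
  finitely_generated (L `&` H).
Proof.
move=> nK [a Ha quo] sL [s sLK sP]; have [sK sH KH _] := nK.
have zH k : H (zpow a k) by apply: subgroupZ.
have [K1 KM KV] := sK; have [H1 HM HV] := sH; have [L1 LM LV] := sL.
have Hdec h : H h -> exists k, K ((zpow a k)^-1 * h).
  move=> Hh; have : cosets H K (left_coset h K) by exists h.
  by rewrite quo => -[k _ /(left_coset_eqP _ _ sK) e]; exists k; apply: e.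
pose D k := exists2 h, L h /\ H h & K ((zpow a k)^-1 * h).
have [|||d [h0 [Lh0 Hh0] Kh0] dP] := @int_subgroup_generator D.
- by exists 1 => //=; rewrite invg1 mulg1.
- move=> k l [h [Lh Hh] Kh] [h' [Lh' Hh'] Kh'].
  exists (h * h'); first by split; [apply: LM|apply: HM].
  by rewrite zpowD; apply: (coset_congM nK).
- move=> k [h [Lh Hh] Kh]; exists h^-1; first by split; [apply: LV|apply: HV].
  by rewrite zpowN; apply: (coset_congV nK).
exists (h0 :: s) => [x [<-//|/sLK[Lx /KH Hx]//]|M sM Ms h [Lh Hh]].
have [k Kk] := Hdec h Hh.
have [l kl] : exists l : int, k = (d * l)%R by apply: dP; exists h.
have Mh0 : M (zpow h0 l) by apply: subgroupZ => //; apply: Ms; left.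
(* Both [h] and [zpow h0 l] are congruent to [zpow a k], so they differ by an element of [L] lying
   in [K]. *)
rewrite -(mulVKg (zpow h0 l) h); have [_ MM _] := sM; apply: MM => //.
apply: sP => [//|x sx|]; first by apply: Ms; right.
split; first by apply: LM => //; apply: LV; apply: subgroupZ.
rewrite -(mulVKg (zpow a k) h) mulgA; apply: KM => //.
rewrite kl zpowM -[X in _ * X]invgK -invgM; apply: KV.
exact: (coset_congZ _ nK).
Qed.

Lemma fg_sub_polycyclic H L : polycyclic H -> subgroup L -> L `<=` H ->
  finitely_generated L.
Proof.
move=> [r [S [S0 Sr step]]] sL LH.
suff fg i : (i <= r)%N -> finitely_generated (L `&` S i).
  by rewrite -(setIidl LH) -Sr; apply: fg.
elim: i => [_|i IHi ir].
  have -> : L `&` S 0%N = cyclic_group 1; last exact: fg_cyclic.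
  rewrite S0; apply/seteqP; split=> [_ [_ ->]|_ [k _ <-]]; first by exists 0%R.
  split; first by case: sL (sL) => L1 _ _ sL; apply: subgroupZ.
  exact: (subgroupZ _ subgroup1).
have [nS cS] := step i ir.
exact: fg_polycyclic_step nS cS sL (IHi (ltnW ir)).
Qed.

Lemma fg_sub_virtually_polycyclic H L :
  virtually_polycyclic H -> subgroup L -> L `<=` H -> finitely_generated L.
Proof.
move=> [K [sK sH KH fin] pK] sL LH.
apply: (@fg_finite_index (L `&` K)); last first.
  by apply: fg_sub_polycyclic pK _ _; [apply: subgroupI|move=> x []].
have [L1 LM LV] := sL.
split=> [|//|x []//|]; first exact: subgroupI.
apply: finite_image_factor (sub_finite_set (image_subset _ LH) fin) _.
move=> a b La Lb /(left_coset_eqP _ _ sK) Kab.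
apply/left_coset_eqP; first exact: subgroupI.
by split=> //; apply: LM => //; apply: LV.
Qed.

(** * Normal cores and derived series *)

Definition normal_core K H : set gT :=
  [set x | H x /\ forall a, H a -> K (x ^ a)].

Lemma normal_core_normal K H : finite_index_subgroup K H ->
  normal_subgroup (normal_core K H) H.
Proof.
move=> [[K1 KM KV] sH _ _]; have [H1 HM HV] := sH; split=> [|//|x []//|a Ha].
  split=> [|x y [Hx Kx] [Hy Ky]|x [Hx Kx]].
  - by split=> // a _; rewrite conj1g.
  - by split=> [|a Ha]; [apply: HM|rewrite conjMg; apply: KM; auto].
  - by split=> [|a Ha]; [apply: HV|rewrite conjVg; apply: KV; auto].
move=> _ [x [Hx Kx] <-]; split; first exact: subgroupJ.
by move=> b Hb; rewrite -conjgM; apply: Kx; apply: HM.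
Qed.

(** Left multiplication by [x] permutes the finitely many cosets of [K]. Recording the coset of
    [x * t] for each [t] in a transversal leaves finitely many values, and these determine [x]
    modulo the core. *)
Lemma normal_core_finite_index K H : finite_index_subgroup K H ->
  finite_index_subgroup (normal_core K H) H.
Proof.
move=> fiK; have [sK sH KH fin] := fiK.
have [sC _ CH _] := normal_core_normal fiK; have [H1 HM HV] := sH.
split=> //; have [s sH' sP] := finite_cosets_transversal sK fin.
have [K1 KM KV] := sK.
apply: (@finite_cosetsI _ _ (fun x => [seq left_coset (x * t) K | t <- s])).
- exact: sC.
- apply: (@finite_image_tuple _ _ _ H s (fun t x => left_coset (x * t) K)).
  move=> t /sH' Ht; apply: sub_finite_set fin => _ [x Hx <-].
  by exists (x * t) => //; apply: HM.
move=> x y Hx Hy /(@eq_map_In _ _ _ s (fun t x => left_coset (x * t) K)) e.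
split; first by apply: HM => //; apply: HV.
move=> a Ha; have [t st Kta] := sP _ Ha.
have /(left_coset_eqP _ _ sK) Kt := e t st.
(* Conjugating by [a] means conjugating first by [t], which lands in [K] by equality of the cosets,
   and then by the element [t^-1 * a] of [K]. *)
rewrite (_ : _ ^ a = (t^-1 * a)^-1 * ((x * t)^-1 * (y * t)) * (t^-1 * a)).
  by apply: (KM) => //; apply: KM => //; apply: KV.
by rewrite conjgE !invgM !invgK !mulgA !mulgK.
Qed.

(** The subgroup generated by commutators is encoded as an intersection, so inclusion in a subgroup
    is checked on commutators alone. *)
Definition derived_group H : set gT :=
  [set x | forall K, subgroup K ->
     (forall a b, H a -> H b -> K [~ a, b]) -> K x].

Lemma derived_group_subgroup H : subgroup (derived_group H).
Proof.
split=> [K [K1 _ _] _ //|x y Hx Hy K sK KH|x Hx K sK KH].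
  by have [_ KM _] := sK; apply: KM; [apply: Hx|apply: Hy].
by have [_ _ KV] := sK; apply: KV; apply: Hx.
Qed.

Lemma derived_groupR H a b : H a -> H b -> derived_group H [~ a, b].
Proof. by move=> Ha Hb K _; apply. Qed.

Lemma derived_group_min H K : subgroup K ->
  (forall a b, H a -> H b -> K [~ a, b]) -> derived_group H `<=` K.
Proof. by move=> sK KH x; apply. Qed.

Lemma derived_groupS H K : H `<=` K -> derived_group H `<=` derived_group K.
Proof.
move=> HK; apply: derived_group_min; first exact: derived_group_subgroup.
by move=> a b Ha Hb; apply: derived_groupR; apply: HK.
Qed.

Lemma derived_group_sub H : subgroup H -> derived_group H `<=` H.
Proof.
move=> sH; have [_ HM HV] := sH; apply: derived_group_min => // a b Ha Hb.
by apply: HM (HV _ Ha) _; apply: subgroupJ.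
Qed.

Lemma derived_group_normal H K : normal_subgroup H K ->
  normal_subgroup (derived_group H) K.
Proof.
move=> nH; have [sH sK HK _] := nH; split=> [|//||a Ka].
- exact: derived_group_subgroup.
- by move=> x /(derived_group_sub sH)/HK.
move=> _ [x Hx <-] L sL LH; have [L1 LM LV] := sL.
(* The subgroup [L] is pulled back along conjugation by [a], which permutes commutators of [H]. *)
apply: (Hx [set y | L (y ^ a)]).
  split=> /= [|y z Ly Lz|y Ly]; first by rewrite conj1g.
    by rewrite conjMg; apply: LM.
  by rewrite conjVg; apply: LV.
move=> b c Hb Hc /=; rewrite conjRg.
by apply: LH; apply: normalJ nH _ Ka.
Qed.

(** Modulo [K] both [x] and [y] are powers of [a], so [x * y] and [y * x] are congruent to the same
    power. *)
Lemma derived_group_cyclic_quotient K H :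
  normal_subgroup K H -> cyclic_quotient H K -> derived_group H `<=` K.
Proof.
move=> nK [a Ha quo]; have [sK sH KH _] := nK; have [K1 KM KV] := sK.
have Hdec h : H h -> exists k, K ((zpow a k)^-1 * h).
  move=> Hh; have : cosets H K (left_coset h K) by exists h.
  by rewrite quo => -[k _ /(left_coset_eqP _ _ sK) e]; exists k; apply: e.
apply: derived_group_min => // x y Hx Hy.
have [k Kx] := Hdec x Hx; have [l Ky] := Hdec y Hy.
have zH i : H (zpow a i) by apply: subgroupZ.
have := coset_congM nK (zH k) Ky Kx; have := coset_congM nK (zH l) Kx Ky.
rewrite (zpowC a l k) => Kxy Kyx.
rewrite (_ : [~ x, y] = ((zpow a k * zpow a l)^-1 * (y * x))^-1 *
                        ((zpow a k * zpow a l)^-1 * (x * y))).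
  by apply: KM => //; apply: KV.
move: (zpow a k * zpow a l) => c.
by rewrite commgEl conjgE (invgM c^-1) invgK invgM -!mulgA mulVKg.
Qed.

(** The derived series descends at least as fast as the polycyclic series. *)
Lemma polycyclic_derived H : polycyclic H ->
  exists r, iter r derived_group H `<=` [set 1].
Proof.
move=> [r [S [S0 Sr step]]]; exists r; rewrite -S0.
suff D j : (j <= r)%N -> iter j derived_group H `<=` S (r - j)%N.
  by have := D r (leqnn r); rewrite subnn.
elim: j => [_|j IHj jr] /=; first by rewrite subn0 Sr.
have [nS cS] := step (r - j.+1)%N ltac:(lia).
rewrite -subSn // subSS in nS cS.
apply: subset_trans (derived_groupS (IHj (ltnW jr))) _.
exact: derived_group_cyclic_quotient nS cS.
Qed.

Lemma iter_derived_normal n H K : normal_subgroup H K ->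
  normal_subgroup (iter n derived_group H) K.
Proof. by move=> nH; elim: n => //= n; apply: derived_group_normal. Qed.

Lemma iter_derivedS n H K : H `<=` K ->
  iter n derived_group H `<=` iter n derived_group K.
Proof. by move=> HK; elim: n => //= n; apply: derived_groupS. Qed.

End Groups.

(** * Minimal sets *)

Section Compactness.
Set Implicit Arguments.
Unset Strict Implicit.
Context {X : topologicalType}.
Implicit Types (A B K U V : set X).

(* The complements of the sets satisfying [P] form a filter, which would have a
   cluster point in [K] if [K] did not satisfy [P]. *)
Lemma compact_local_ind K (P : set X -> Prop) :
    compact K -> P set0 -> (forall A B, A `<=` B -> P B -> P A) ->
    (forall A B, P A -> P B -> P (A `|` B)) ->
    (forall x, K x -> exists2 U, nbhs x U & P U) ->
  P K.
Proof.
move=> cK P0 Psub PU Ploc; apply: contrapT => nPK.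
pose F := [set A | P (K `\` A)].
have FF : ProperFilter F.
  split; first by rewrite /F /= setD0.
  split=> [|A B FA FB|A B AB]; first by rewrite /F /= setDT.
    by rewrite /F /= setDIr; apply: PU.
  by apply: Psub => x [Kx nBx]; split=> // /AB.
have FK : F K by rewrite /F /= setDv.
have [x [Kx clFx]] := cK F FF FK.
have [U xU PU'] := Ploc x Kx.
have FU : F (~` U) by apply: Psub PU' => y [_ /contrapT].
by have [y [nUy /nUy]] := clFx _ _ FU xU.
Qed.

Lemma near_List (T : Type) (s : seq T) (P : T -> X -> Prop) (x : X) :
    (forall i, List.In i s -> \forall y \near x, P i y) ->
  \forall y \near x, forall i, List.In i s -> P i y.
Proof.
elim: s => [_|i s IHs Ps]; first exact: filterE.
have Pi := Ps i (or_introl erefl).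
have {}IHs := IHs (fun j sj => Ps j (or_intror sj)).
by apply: filterS2 Pi IHs => y Piy Psy j [<-|/Psy].
Qed.

(** Baire's theorem for finite covers: either the first set contains [U], or the rest of [U] is
    open, nonempty and covered by the other sets. *)
Lemma finite_closed_cover_interior (s : seq (set X)) U :
    (forall F, List.In F s -> closed F) -> open U -> U !=set0 ->
    (forall x, U x -> exists2 F, List.In F s & F x) ->
  exists2 F, List.In F s & F° !=set0.
Proof.
elim: s U => [|F s IHs] U Fcl Uo [x Ux] Ucov; first by have [] := Ucov x Ux.
have [UF|/existsNP[y /not_implyP[Uy nFy]]] := pselect (U `<=` F).
  exists F; first by left.
  by exists x; apply: filterS UF _; apply: open_nbhs_nbhs.
have [||||G sG G0] := IHs (U `\` F).
- by move=> G sG; apply: Fcl; right.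
- by apply: openI => //; apply: closed_openC; apply: Fcl; left.
- by exists y.
- by move=> z [Uz nFz]; have [G [<- //|sG] Gz] := Ucov z Uz; exists G.
by exists G => //; right.
Qed.

Lemma locally_constant_finite (T : Type) (f : X -> T) K : compact K ->
  (forall x, K x -> \forall y \near x, f y = f x) -> finite_set (f @` K).
Proof.
move=> cK floc; apply: (@compact_local_ind K (fun A => finite_set (f @` A))).
- exact: cK.
- by rewrite image_set0.
- by move=> A B AB; apply: sub_finite_set; apply: image_subset.
- by move=> A B fA fB; rewrite image_setU finite_setU.
move=> x Kx; exists [set y | f y = f x]; first exact: floc.
by apply: sub_finite_set (finite_set1 (f x)) => _ [y /= -> <-].
Qed.

Lemma finite_closed A : hausdorff_space X -> finite_set A -> closed A.
Proof.
move=> hX; apply: accessible_finite_set_closed.1; exact: hausdorff_accessible.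
Qed.

Lemma clopen_clopen_in (Y A : set X) : A `<=` Y -> clopen A -> clopen_in Y A.
Proof.
by move=> AY [oA cA]; split=> //; split;
  [apply: open_subspaceW|apply: closed_subspaceW].
Qed.

Lemma finite_clopen_in (Y A : set X) : hausdorff_space X ->
  finite_set Y -> A `<=` Y -> clopen_in Y A.
Proof.
move=> hX fY AY; split=> //; split; last first.
  by apply: closed_subspaceW; apply: (finite_closed hX (sub_finite_set AY fY)).
apply/open_subspaceP; exists (~` (Y `\` A)).
  by apply: closed_openC; apply: finite_closed hX (finite_setD _ fY).
apply/seteqP; split=> x [nYA Yx]; split=> //; last by move=> [].
by apply: contrapT => nAx; apply: nYA.
Qed.

End Compactness.

(** * Orbits, invariant sets and existence of minimal sets *)

Section HomeoAction.
Set Implicit Arguments.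
Unset Strict Implicit.
Local Open Scope group_scope.
Context {X : topologicalType}.
(* Otherwise [orbit] denotes [fingraph.orbit]. *)
Local Notation orbit := (@Defs.orbit _).
Implicit Types (f g h : homeo X) (G H K : set (homeo X)) (A P W Y : set X).

Lemma homeoVK h x : h^-1 (h x) = x.
Proof. exact: homeo_funK. Qed.

Lemma homeoKV h x : h (h^-1 x) = x.
Proof. exact: homeo_invK. Qed.

Lemma homeo_inj h : injective h.
Proof. exact: can_inj (homeo_funK h). Qed.

Lemma zpow_homeoD g k l x : zpow g (k + l)%R x = zpow g k (zpow g l x).
Proof. by rewrite zpowD. Qed.

Lemma zpow_homeoN g k x y : zpow g k x = y <-> x = zpow g (- k)%R y.
Proof.
split=> [<-|->]; first by rewrite -zpow_homeoD GRing.addNr.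
by rewrite -zpow_homeoD GRing.addrN.
Qed.

Lemma group_invariantP G Y : subgroup G ->
  group_invariant G Y <-> forall h, G h -> forall y, Y y -> Y (h y).
Proof.
move=> [_ _ GV]; split=> [iY h Gh y Yy|iY h Gh].
  by rewrite -(iY h Gh); exists y.
apply/seteqP; split=> [_ [y Yy <-]|y Yy]; first exact: iY.
by exists (h^-1 y); [apply: iY => //; apply: GV|rewrite homeoKV].
Qed.

Lemma orbitM G x y h : subgroup G -> G h -> orbit G x y -> orbit G x (h y).
Proof. by move=> [_ GM _] Gh [a Ga <-]; exists (h * a) => //; apply: GM. Qed.

Lemma orbit_self G x : subgroup G -> orbit G x x.
Proof. by move=> [G1 _ _]; exists 1. Qed.

Lemma orbit_sym G x y : subgroup G -> orbit G x y -> orbit G y x.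
Proof. by move=> [_ _ GV] [a Ga <-]; exists a^-1; [apply: GV|rewrite homeoVK]. Qed.

Lemma orbit_trans G x y z : subgroup G ->
  orbit G x y -> orbit G y z -> orbit G x z.
Proof. by move=> sG xy [a Ga <-]; apply: orbitM. Qed.

Lemma orbit_eq G x y : subgroup G -> orbit G x y -> orbit G x = orbit G y.
Proof.
move=> sG xy; apply/seteqP; split=> z; apply: orbit_trans => //.
exact: orbit_sym.
Qed.

Lemma orbit_invariant G x : subgroup G -> group_invariant G (orbit G x).
Proof. by move=> sG; apply/group_invariantP => // h Gh y; apply: orbitM. Qed.

Lemma orbit_sub G Y x : subgroup G -> group_invariant G Y -> Y x ->
  orbit G x `<=` Y.
Proof. by move=> sG /(group_invariantP _ sG) iY Yx _ [h Gh <-]; apply: iY. Qed.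

Lemma orbitS G H x : G `<=` H -> orbit G x `<=` orbit H x.
Proof. exact: image_subset. Qed.

Lemma group_invariantS G H Y : G `<=` H -> group_invariant H Y ->
  group_invariant G Y.
Proof. by move=> GH iY h /GH; apply: iY. Qed.

Lemma periodic_invariant G : subgroup G -> group_invariant G (periodic_part G).
Proof.
move=> sG; apply/group_invariantP => // h Gh y; rewrite /periodic_part /=.
by rewrite (@orbit_eq G y (h y)) //; apply: orbitM => //; apply: orbit_self.
Qed.

Lemma group_invariantD G A Y : subgroup G ->
  group_invariant G A -> group_invariant G Y -> group_invariant G (A `\` Y).
Proof.
move=> sG /(group_invariantP _ sG) iA /(group_invariantP _ sG) iY.
have [_ _ GV] := sG.
apply/group_invariantP => // h Gh y [Ay nYy]; split; first exact: iA.
by move=> /(iY _ (GV _ Gh)); rewrite homeoVK.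
Qed.

Lemma group_invariantI G A Y : subgroup G ->
  group_invariant G A -> group_invariant G Y -> group_invariant G (A `&` Y).
Proof.
move=> sG /(group_invariantP _ sG) iA /(group_invariantP _ sG) iY.
by apply/group_invariantP => // h Gh y [Ay Yy]; split; [apply: iA|apply: iY].
Qed.

(** The elements that preserve [P] together with their inverses form a subgroup, so generators
    suffice. *)
Lemma fg_stable G (s : seq (homeo X)) P : subgroup G ->
    (forall K, subgroup K -> (forall h, List.In h s -> K h) -> G `<=` K) ->
    (forall h, List.In h s -> forall x, P x -> P (h x) /\ P (h^-1 x)) ->
  forall h, G h -> forall x, P x -> P (h x).
Proof.
move=> sG gen sP h Gh x Px.
pose K := [set h : homeo X | forall x, P x -> P (h x) /\ P (h^-1 x)].
have [||//] := gen K _ _ h Gh x Px.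
  split=> [y Py|a b Ka Kb y Py|a Ka y Py]; first by rewrite invg1.
    rewrite invgM; have [/Ka[Pab _] _] := Kb y Py.
    by have [_ /Kb[_ Pba]] := Ka y Py.
  by rewrite invgK; have [] := Ka y Py.
exact: sP.
Qed.

Lemma zpow_fix_finite_orbit g k x : k != 0%R -> zpow g k x = x ->
  finite_set (orbit (cyclic_group g) x).
Proof.
move=> k0 fix_x.
have fixM l : zpow g (k * l)%R x = x.
  elim/int_ind: l => [|n IHn|n IHn]; first by rewrite GRing.mulr0.
    by rewrite -addn1 PoszD GRing.mulrDr GRing.mulr1 GRing.addrC zpow_homeoD IHn.
  apply/zpow_homeoN; rewrite (_ : (- _ = k * n%:Z + k)%R); last by lia.
  rewrite zpow_homeoD fix_x; have /zpow_homeoN e := IHn.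
  by rewrite [LHS]e; congr (zpow g _ x); lia.
(* Reducing exponents modulo the absolute value of [k] leaves only the powers with exponent below
   it. *)
have fin := finite_image (fun r : nat => zpow g r%:Z x) (finite_II `|k|%N).
apply: sub_finite_set fin => _ [_ [l _ <-] <-].
pose K := Posz `|k|%N; have K_gt0 : (0 < K)%R by rewrite /K; lia.
have r_ge0 : (0 <= (l %% K)%Z)%R by apply: modz_ge0; lia.
have r_lt : ((l %% K)%Z < K)%R by apply: ltz_pmod.
have fixK j : zpow g (j * K)%R x = x.
  have [->|->] : K = k \/ K = (- k)%R by rewrite /K; lia.
    by rewrite GRing.mulrC fixM.
  by rewrite GRing.mulrN -GRing.mulNr GRing.mulrC fixM.
exists `|(l %% K)%Z|%N; first by rewrite /= -ltz_nat gez0_abs.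
have -> : zpow g l x = zpow g ((l %% K)%Z + (l %/ K)%Z * K)%R x.
  by rewrite GRing.addrC -divz_eq.
by rewrite zpow_homeoD fixK gez0_abs.
Qed.

Lemma minimal_orbit_infinite G Y x : hausdorff_space X -> subgroup G ->
  minimal G Y -> infinite_set Y -> Y x -> infinite_set (orbit G x).
Proof.
move=> hX sG [_ iY mY] infY Yx fin; apply: infY.
have [orb0|e] := mY (orbit G x) (finite_closed hX fin)
  (orbit_sub sG iY Yx) (orbit_invariant x sG); last by rewrite -e.
by have := orbit_self x sG; rewrite orb0.
Qed.

Lemma minimal_sub G Y C : subgroup G -> minimal G Y -> closed C ->
  group_invariant G C -> closed Y -> Y `&` C !=set0 -> Y `<=` C.
Proof.
move=> sG [_ iY mY] cC iC cY [x [Yx Cx]].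
have [e|e] := mY (Y `&` C) (closedI cY cC) (@subIsetl _ _ _)
  (group_invariantI sG iY iC).
  by have : (Y `&` C) x by []; rewrite e.
by rewrite -e; apply: subIsetr.
Qed.

Lemma minimal_eq G Y W : subgroup G -> minimal G Y -> minimal G W ->
  closed Y -> closed W -> Y `&` W !=set0 -> Y = W.
Proof.
move=> sG mY mW cY cW YW; have [_ iY _] := mY; have [_ iW _] := mW.
apply/seteqP; split; first exact: minimal_sub sG mY cW iW cY YW.
by apply: minimal_sub sG mW cY iY cW _; rewrite setIC.
Qed.

(** Zorn's lemma is applied to complements, that is, to open invariant sets that do not cover [C].
    By compactness the union of a chain of them does not cover [C] either. *)
Lemma exists_minimal G (C : set X) : compact [set: X] -> subgroup G ->
    closed C -> group_invariant G C -> C !=set0 ->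
  exists W, [/\ closed W, W `<=` C & minimal G W].
Proof.
move=> cX sG cC iC [c0 Cc0].
pose P (U : set X) := [/\ open U, group_invariant G U & C `\` U !=set0].
have [F FP Ftot|U [[oU iU CU0] Umax]] := @Zorn_bigcup X P.
  split; first by apply: bigcup_open => U /FP[].
    apply/group_invariantP => // h Gh y [U FU Uy]; exists U => //.
    by have [_ /(group_invariantP _ sG) iU _] := FP _ FU; apply: iU.
  apply: contrapT => Cemp.
  (* The first alternative serves the empty set, for which an empty chain offers no [U]. *)
  have : C `<=` set0 \/ exists2 U, F U & C `<=` U.
    apply: (@compact_local_ind _ C
      (fun S => S `<=` set0 \/ exists2 U, F U & S `<=` U)).
    - exact: subclosed_compact cC cX _.
    - by left.
    - move=> A B AB [B0|[U FU BU]]; first by left; apply: subset_trans B0.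
      by right; exists U => //; apply: subset_trans BU.
    - move=> A B [A0|[U FU AU]] [B0|[V FV BV]].
      + by left=> x [/A0|/B0].
      + by right; exists V => // x [/A0|/BV].
      + by right; exists U => // x [/AU|/B0].
      + have [UV|VU] := Ftot U V FU FV; right.
          by exists V => // x [/AU/UV|/BV].
        by exists U => // x [/AU|/BV/VU].
    move=> x Cx; have [U FU Ux] : (\bigcup_(U in F) U) x.
      by apply: contrapT => nUx; apply: Cemp; exists x.
    exists U; last by right; exists U.
    by apply: open_nbhs_nbhs; have [oU _ _] := FP _ FU.
  move=> [C0|[U FU CU]]; first exact: C0 Cc0.
  by have [_ _ [x [/CU]]] := FP _ FU.
exists (C `\` U); split=> [||].
- by apply: closedI => //; apply: open_closedC.
- by move=> x [].
split=> [//||D cD DCU iD]; first exact: group_invariantD.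
have [DU|[x [[Cx nUx] nDx]]] : C `\` U `<=` D \/ (C `\` U) `\` D !=set0.
- have [|/existsNP[x /not_implyP[CUx nDx]]] := pselect (C `\` U `<=` D).
    by left.
  by right; exists x.
- by right; apply/seteqP; split.
left; apply/seteqP; split=> // y Dy.
(* A point [y] of [D] makes the complement of [D] an admissible open set, strictly larger than [U]
   because of [x]. *)
apply: (Umax (~` D)); first split.
- by move=> z Uz /DCU[].
- by move=> /(_ x nDx).
split; first exact: closed_openC.
  by rewrite -setTD; apply: group_invariantD => //; apply/group_invariantP.
by exists y; have [Cy _] := DCU y Dy; split=> //; apply.
Qed.

End HomeoAction.

(** * Bounded displacement *)

Section Displacement.
Set Implicit Arguments.
Unset Strict Implicit.
Local Open Scope group_scope.
Context {X : topologicalType}.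
Local Notation orbit := (@Defs.orbit _).
Implicit Types (f g h : homeo X) (G H K : set (homeo X)) (A P W Y : set X).

Lemma homeo_near h x U : nbhs (h x) U -> \forall y \near x, U (h y).
Proof. exact: homeo_fun_continuous. Qed.

Lemma homeo_preimage_closed h A : closed A -> closed (h @^-1` A).
Proof. by apply: preimage_closed => x _; apply: homeo_fun_continuous. Qed.

Lemma homeo_near_neq h x : hausdorff_space X ->
  h x <> x -> \forall y \near x, h y <> y.
Proof.
rewrite open_hausdorff => hX /eqP/hX[[A B] /= [hxA xB] [oA oB /eqP AB]].
have nA : \forall y \near x, A (h y).
  by apply: homeo_near; apply: open_nbhs_nbhs; split=> //; rewrite -in_setE.
have nB : nbhs x B by apply: open_nbhs_nbhs; split=> //; rewrite -in_setE.
apply: filterS2 nA nB => y Ay By e; rewrite e in Ay.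
by have : (A `&` B) y by []; rewrite AB.
Qed.

Lemma closure_orbit_invariant G x : subgroup G ->
  group_invariant G (closure (orbit G x)).
Proof.
move=> sG; apply/group_invariantP => // h Gh y cly U /homeo_near/cly[z [xz Uz]].
by exists (h z); split=> //; apply: orbitM.
Qed.

Lemma interior_invariant G Y : subgroup G -> group_invariant G Y ->
  group_invariant G (Y°).
Proof.
move=> sG /(group_invariantP _ sG) iY; apply/group_invariantP => // h Gh y Yy.
rewrite /interior.
have : \forall z \near h y, Y (h^-1 z) by apply: homeo_near; rewrite homeoVK.
by apply: filterS => z /(iY _ Gh); rewrite homeoKV.
Qed.

(** Removing the interior from [Y] leaves a closed invariant proper subset, which must be empty. *)
Lemma minimal_open_of_interior G Y : subgroup G -> closed Y -> minimal G Y ->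
  Y° !=set0 -> open Y.
Proof.
move=> sG cY [_ iY mY] [y Yy].
have [|||e|e] := mY (Y `\` Y°).
- by apply: closedI => //; apply: open_closedC; apply: open_interior.
- by move=> x [].
- by apply: group_invariantD => //; apply: interior_invariant.
- rewrite openE => x Yx; apply: contrapT => nYx.
  by have : (Y `\` Y°) x by []; rewrite e.
- have : Y y by apply: interior_subset.
  by rewrite -[in X in X -> _]e => -[].
Qed.

(** The property of the full group on which the study of finite orbits rests: fixed point sets are
    open. *)
Definition locally_fixing G := forall h x, G h -> h x = x ->
  \forall y \near x, h y = y.

(** The finite orbit of [w] is copied near [w]. With [r v] in [G] carrying [w] to [v], the relations
    [h (r v y) = r (h v) y], for generators [h], hold at [w] and hence near [w]; they extend to all
    of [G]. So the orbit of [y] consists of points [r v y], and those with [v] other than [w] differ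
    from [y]. *)
Lemma near_stabilizer G w : hausdorff_space X -> subgroup G ->
    finitely_generated G -> locally_fixing G -> periodic_part G w ->
  \forall y \near w, stabilizer G y = stabilizer G w /\ periodic_part G y.
Proof.
move=> hX sG [s sGs gen] locG wper; have [G1 GM GV] := sG.
have [ob oP] := finite_set_List wper.
pose r v := if pselect (exists2 h, G h & h w = v) is left e
            then sval (cid2 e) else 1.
have rP v : orbit G w v -> G (r v) /\ r v w = v.
  by move=> wv; rewrite /r; case: pselect => [e|[]//]; case: cid2.
have ow : orbit G w w by apply: orbit_self.
have Nr : \forall y \near w, r w y = y.
  by have [Gr rw] := rP w ow; apply: locG.
have Ngen : \forall y \near w, forall h, List.In h s ->
    forall v, List.In v ob -> h (r v y) = r (h v) y.
  apply: near_List => h /sGs Gh; apply: near_List => v /oP wv.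
  have [Grv rv] := rP v wv; have [Grhv rhv] := rP (h v) (orbitM sG Gh wv).
  have : \forall y \near w, ((r (h v))^-1 * (h * r v)) y = y.
    apply: locG; first by apply: (GM); [apply: GV|apply: GM].
    by apply: (@homeo_inj _ (r (h v))); rewrite /= homeo_invK rv rhv.
  by apply: filterS => y e; rewrite -[in RHS]e; apply/esym; apply: homeo_invK.
have Nneq : \forall y \near w, forall v, List.In v ob ->
    v <> w -> r v y <> r w y.
  apply: near_List => v /oP wv.
  have [->|/eqP vw] := eqVneq v w; first exact: filterE.
  have [Grv rv] := rP v wv; have [Grw rw] := rP w ow.
  have : \forall y \near w, ((r w)^-1 * r v) y <> y.
    apply: homeo_near_neq => //= e; apply: vw.
    by have := congr1 (r w) e; rewrite homeo_invK rw rv.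
  by apply: filterS => y ne _ e; apply: ne; rewrite /= e homeo_funK.
apply: filterS3 Nr Ngen Nneq => y ry geny neqy.
have equi h v : G h -> orbit G w v -> h (r v y) = r (h v) y.
  pose K := [set h : homeo X | G h /\
                  forall v, orbit G w v -> h (r v y) = r (h v) y].
  move=> Gh wv; suff [_] : K h by apply.
  apply: gen Gh => [|a sa]; last first.
    by split=> [|u /oP ou]; [apply: sGs|apply: geny].
  split=> [//|a b [Ga Ka] [Gb Kb]|a [Ga Ka]].
    split=> [|u wu] /=; first exact: GM.
    by rewrite Kb // Ka //; apply: orbitM.
  split=> [|u wu]; first exact: GV.
  have wau : orbit G w (a^-1 u) by apply: orbitM => //; apply: GV.
  by apply: (@homeo_inj _ a); rewrite homeoKV Ka // homeoKV.
have hy h : G h -> h y = r (h w) y by move=> Gh; rewrite -equi // ry.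
split.
  apply/seteqP; split=> h [Gh fix_h]; split=> //.
    have [//|/eqP hw] := eqVneq (h w) w.
    have wh : orbit G w (h w) by apply: orbitM.
    by have := neqy (h w) ((oP _).1 wh) hw; rewrite -hy // fix_h ry.
  by rewrite hy // fix_h ry.
apply: sub_finite_set (finite_image (fun v => r v y) wper) => _ [h Gh <-].
by exists (h w); [apply: orbitM|rewrite [RHS]hy].
Qed.

Definition bounded_displacement g h (R : nat) :=
  forall x, exists2 k : int, (`|k| <= R)%N & h x = zpow g k x.

Lemma bounded_displacementV g h R :
  bounded_displacement g h R -> bounded_displacement g h^-1 R.
Proof.
move=> bh y; have [k kR e] := bh (h^-1 y); exists (- k)%R; first by lia.
by apply/zpow_homeoN; rewrite -e homeoKV.
Qed.

Lemma bounded_displacement_uniform g (s : seq (homeo X)) :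
    (forall h, List.In h s -> exists R, bounded_displacement g h R) ->
  exists R, forall h, List.In h s -> bounded_displacement g h R.
Proof.
elim: s => [_|h s IHs bs]; first by exists 0%N.
have [R bR] := IHs (fun a sa => bs a (or_intror sa)).
have [Q bQ] := bs h (or_introl erefl).
exists (maxn Q R) => a [<-|/bR ba] x; first have [k kR e] := bQ x.
  by exists k => //; lia.
by have [k kR e] := ba x; exists k => //; lia.
Qed.

(* Generators move by at most [R], so an orbit cannot jump over a gap of
   length [R]; [e] is the direction, [1] or [-1]. *)
Lemma orbit_gap g G (s : seq (homeo X)) (R : nat) (e M : int) x :
    subgroup G ->
    (forall K, subgroup K -> (forall h, List.In h s -> K h) -> G `<=` K) ->
    (forall h, List.In h s -> G h /\ bounded_displacement g h R) ->
    e = 1%R \/ e = (- 1)%R -> (0 < M)%R ->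
    (forall n : int, (M <= n < M + R%:Z)%R ->
       ~ orbit G x (zpow g (e * n)%R x)) ->
  forall y, orbit G x y -> exists2 n : int, (n < M)%R & y = zpow g (e * n)%R x.
Proof.
move=> sG gen bs e1 M0 gap _ [h Gh <-].
pose P y := orbit G x y /\ exists2 n : int, (n < M)%R & y = zpow g (e * n)%R x.
have step a y : G a -> bounded_displacement g a R -> P y -> P (a y).
  move=> Ga ba [xy [n nM ey]]; split; first exact: orbitM.
  have [k kR ea] := ba y; have {}ea : a y = zpow g (e * (n + e * k))%R x.
    rewrite ea ey -zpow_homeoD; congr (zpow g _ x).
    by case: e1 => ->; lia.
  (* A move of at most [R] starting below [M] cannot pass the gap: reaching [M] would mean landing
     inside it. *)
  exists (n + e * k)%R => //; apply: contrapT => /negP nk.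
  apply: (gap (n + e * k)%R); first by case: e1 nk => ->; lia.
  by rewrite -ea; apply: orbitM.
have Px : P x.
  split; first exact: orbit_self.
  by exists 0%R => //; rewrite GRing.mulr0.
suff [] : P (h x) by [].
apply: (fg_stable sG gen) (Px) => // a sa y Py; have [Ga ba] := bs a sa.
have [_ _ GV] := sG; split; first exact: step.
by apply: step => //; [apply: GV|apply: bounded_displacementV].
Qed.

(** With a gap in both directions, [orbit_gap] would confine the orbit to a finite stretch of the
    [g]-orbit. The length [R] bounds the displacement of the generators, hence does not depend on
    [x]. *)
Lemma orbit_windows g G : subgroup G -> finitely_generated G ->
    (forall h, G h -> exists R, bounded_displacement g h R) ->
  exists R : nat, forall x, injective (fun k => zpow g k x) ->
    infinite_set (orbit G x) ->
    exists2 e : int, e = 1%R \/ e = (- 1)%R &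
      forall M : int, (0 < M)%R -> exists2 n : int, (M <= n < M + R%:Z)%R &
        orbit G x (zpow g (e * n)%R x).
Proof.
move=> sG [s sGs gen] bG.
have [R bR] := bounded_displacement_uniform (fun h sh => bG h (sGs h sh)).
exists R => x inj_x inf_x; apply: contrapT => no_window.
have gap e : e = 1%R \/ e = (- 1)%R -> exists2 M : int, (0 < M)%R &
    forall y, orbit G x y -> exists2 n : int, (n < M)%R & y = zpow g (e * n)%R x.
  move=> e1; apply: contrapT => noM; apply: no_window; exists e => // M M0.
  apply: contrapT => noW; apply: noM; exists M => //.
  apply: (orbit_gap sG gen (R := R)) => // [h sh|n Mn xn].
    by split; [apply: sGs|apply: bR].
  by apply: noW; exists n.
have [M1 M1_gt0 up] := gap 1%R (or_introl erefl).
have [M2 M2_gt0 down] := gap (- 1)%R (or_intror erefl).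
apply: inf_x; apply: sub_finite_set
  (finite_image (fun i : nat => zpow g (i%:Z - M2)%R x) (finite_II `|(M1 + M2)%R|%N)).
(* Injectivity identifies the exponents found in the two directions, so [n] lies strictly between
   [- M2] and [M1]. *)
move=> y xy; have [n nM1 ey] := up y xy; have [m mM2 ey'] := down y xy.
have nm : (1 * n = - 1 * m)%R by apply: inj_x; rewrite /= -ey -ey'.
exists `|(n + M2)%R|%N; first by rewrite /=; lia.
by rewrite ey; congr (zpow g _ x); lia.
Qed.

Lemma minimal_zpow_injective g A x : hausdorff_space X ->
    minimal (cyclic_group g) A -> infinite_set A -> A x ->
  injective (fun k => zpow g k x).
Proof.
move=> hX mA infA Ax k l /= kl; apply: contrapT => /eqP neq_kl.
apply: (minimal_orbit_infinite hX (subgroup_cyclic g) mA infA Ax).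
apply: (@zpow_fix_finite_orbit _ g (k - l)%R); first by lia.
rewrite GRing.addrC zpow_homeoD kl -zpow_homeoD.
by rewrite (_ : (- l + l = 0)%R) //; lia.
Qed.

(* An infinite [G]-orbit meets every sufficiently long stretch of a half
   [g]-orbit, hence finitely many [g]-translates of [Y] cover [A], and one of
   them has interior points. *)
Lemma minimal_infinite_open g G A Y : compact [set: X] -> hausdorff_space X ->
    subgroup G -> finitely_generated G ->
    (forall h, G h -> exists R, bounded_displacement g h R) ->
    clopen A -> minimal (cyclic_group g) A -> infinite_set A ->
    closed Y -> minimal G Y -> infinite_set Y -> A `&` Y !=set0 ->
  open Y.
Proof.
move=> cX hX sG fgG bG [oA cA] mA infA cY mY infY [x [Ax Yx]].
have [_ iY _] := mY; have [[a0 Aa0] iA minA] := mA.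
have sg := subgroup_cyclic g.
have zA k y : A y -> A (zpow g k y).
  by move=> Ay; apply: (group_invariantP _ sg).1 Ay => //; exists k.
have [R /(_ x (minimal_zpow_injective hX mA infA Ax))] := orbit_windows sG fgG bG.
move=> /(_ (minimal_orbit_infinite hX sG mY infY Yx))[e e1 win].
pose D := [set j : int | (`|j| <= R)%N].
have finD : finite_set D.
  apply: sub_finite_set
    (finite_image (fun i : nat => i%:Z - R%:Z)%R (finite_II R.*2.+1)).
  by move=> j; rewrite /D /= => jR; exists `|(j + R%:Z)%R|%N; rewrite /=; lia.
have [ds dsP] := finite_set_List finD.
pose F j := zpow g j @^-1` Y.
have cF j : closed (F j) by apply: homeo_preimage_closed.
pose C := \bigcup_(j in D) F j.
have cC : closed C by apply: closed_bigcup.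
(* The points of [A] whose whole [g]-orbit stays in [C]. By minimality [E] is empty or equal to [A];
   in the latter case finitely many closed sets [F j] cover [A]. *)
pose E := A `&` \bigcap_(i in [set: int]) (zpow g i @^-1` C).
have cE : closed E.
  apply: closedI => //; apply: closed_bigI => i _.
  exact: homeo_preimage_closed.
have iE : group_invariant (cyclic_group g) E.
  apply/group_invariantP => // _ [k _ <-] y [Ay Ey]; split; first exact: zA.
  by move=> i _; rewrite /= -zpow_homeoD; apply: Ey.
have [E0|EA] := minA E cE (@subIsetl _ _ _) iE; last first.
  have AF y : A y -> exists2 U, List.In U [seq F j | j <- ds] & U y.
    rewrite -EA => -[_ /(_ 0%R I)[j /dsP dsj Fj]]; exists (F j) => //.
    by apply/List.in_map_iff; exists j.
  have [||U sU [y Uy]] := finite_closed_cover_interior _ oA _ AF.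
  - by move=> U /List.in_map_iff[j [<- _]].
  - by exists a0.
  move: sU Uy => /List.in_map_iff[j [<- _]] Fy.
  apply: (minimal_open_of_interior sG cY mY); exists (zpow g j y).
  have : \forall z \near zpow g j y, F j (zpow g (- j)%R z).
    by apply: homeo_near; rewrite -zpow_homeoD GRing.addNr.
  by apply: filterS => z; rewrite /F /= -zpow_homeoD GRing.addrN.
(* If [E] is empty, compactness bounds by [k] the number of steps of [g] needed to leave [C] from
   any point of [A]. *)
have [k kP] : exists k : nat, A `<=`
    [set y | exists2 i : int, (`|i| <= k)%N & ~ C (zpow g i y)].
  apply: (@compact_local_ind _ A (fun S => exists k : nat, S `<=`
      [set y | exists2 i : int, (`|i| <= k)%N & ~ C (zpow g i y)])).
  - exact: subclosed_compact cA cX _.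
  - by exists 0%N.
  - by move=> S T ST [k kT]; exists k; apply: subset_trans kT.
  - move=> S T [k kS] [l lT]; exists (maxn k l) => y [/kS|/lT] [i ik nC];
    by exists i => //; lia.
  move=> y Ay; have [i nC] : exists i, ~ C (zpow g i y).
    apply: contrapT => nC; have : E y; last by rewrite E0.
    by split=> // i _; apply: contrapT => nCi; apply: nC; exists i.
  exists [set z | ~ C (zpow g i z)]; last by exists `|i|%N => z; exists i.
  apply: open_nbhs_nbhs; split=> //.
  exact: closed_openC (homeo_preimage_closed (h := zpow g i) cC).
(* Starting [k.+1] steps from [x] in direction [e] keeps the exit point at a positive distance from
   [x]. A point of the [G]-orbit lies fewer than [R] steps further on, so the exit point is in [C]
   after all. *)
have [i ik] := kP _ (zA (e * k.+1%:Z)%R x Ax); case.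
have [n nM xn] := win (e * i + k.+1%:Z)%R ltac:(case: e1 => ->; lia).
exists (e * (n - (e * i + k.+1%:Z)))%R.
  by rewrite /D /=; case: e1 nM => ->; lia.
rewrite /F /= -!zpow_homeoD.
rewrite [X in zpow g X x](_ : _ = (e * n)%R); last by case: e1 => ->; lia.
exact: (orbit_sub sG iY Yx).
Qed.

End Displacement.

(** * The minimal-periodic partition *)

Section FullGroup.
Set Implicit Arguments.
Unset Strict Implicit.
Local Open Scope group_scope.
Context {X : topologicalType}.
Local Notation orbit := (@Defs.orbit _).
Implicit Types (f g h : homeo X) (G H K : set (homeo X)) (A P W Y : set X).

Lemma full_group_bounded g h : compact [set: X] ->
  topological_full_group g h -> exists R, bounded_displacement g h R.
Proof.
move=> cX [c [cg cloc hc]].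
suff [R RP] : exists R : nat, [set: X] `<=`
    [set x | exists2 k : int, (`|k| <= R)%N & h x = zpow g k x].
  by exists R => x; apply: RP.
apply: (@compact_local_ind _ setT (fun S => exists R : nat, S `<=`
    [set x | exists2 k : int, (`|k| <= R)%N & h x = zpow g k x])).
- exact: cX.
- by exists 0%N.
- by move=> S T ST [k kT]; exists k; apply: subset_trans kT.
- move=> S T [k kS] [l lT]; exists (maxn k l) => y [/kS|/lT] [i ik e];
  by exists i => //; lia.
move=> x _; exists [set y | c y = c x]; first exact: cloc.
have [k _ ck] := cg x; exists `|k|%N => y cy; exists k => //.
by rewrite hc cy ck.
Qed.

Lemma cyclic_groupJ g K a : K `<=` cyclic_group g -> cyclic_group g a ->
  conj_set K a = K.
Proof.
move=> Kg [k _ <-]; have KJ b : K b -> b ^ zpow g k = b.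
  by move=> /Kg[l _ <-]; rewrite conjgE -zpowC mulKg.
apply/seteqP; split=> b; first by move=> [d Kd <-]; rewrite KJ.
by move=> Kb; exists b => //; apply: KJ.
Qed.

(** Near [x] the element [h] acts as one power of [g] fixing [x]. On an infinite minimal piece [g]
    acts freely, so the exponent is zero; on the periodic part the stabilizers in the cyclic group
    are locally constant. *)
Lemma full_group_locally_fixing g : hausdorff_space X ->
  minimal_periodic_partition (cyclic_group g) ->
  locally_fixing (topological_full_group g).
Proof.
move=> hX [m [A [Amin [[oper _] _] _ cov [n [K [_ Kfi [Kin _ Kcov]]]]]]].
move=> h x [c [cg cloc hc]] hx; have [k _ ck] := cg x.
have fix_x : zpow g k x = x by rewrite ck -hc.
have fix_loc : (\forall y \near x, zpow g k y = y) ->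
    \forall y \near x, h y = y.
  by apply: filterS2 (cloc x) => y cy; rewrite hc cy -ck.
have : [set: X] x by [].
rewrite -cov => -[[i _ Ax]|per_x]; apply: fix_loc.
  have [_ infA mA] := Amin i.
  have -> : k = 0%R by apply: (minimal_zpow_injective hX mA infA Ax).
  exact: filterE.
have := per_x; rewrite -Kcov => -[j _ [_ [a ga Ka]]].
have [Kper [/open_subspaceP[V oV Vj] _]] := Kin j.
(* Conjugation is trivial inside the cyclic group, so points of one part have equal stabilizers. *)
have [_ _ Kg _] := Kfi j; rewrite (cyclic_groupJ Kg ga) in Ka.
have [Vx _] : (V `&` periodic_part (cyclic_group g)) x.
  by rewrite Vj; split=> //; split=> //; exists a; rewrite // (cyclic_groupJ Kg ga).
have nV : nbhs x V by apply: open_nbhs_nbhs.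
have nper : nbhs x (periodic_part (cyclic_group g)) by apply: open_nbhs_nbhs.
apply: filterS2 nV nper => y Vy per_y.
have [[_ [b gb Kb]] _] : (conj_stabilizer_part (cyclic_group g)
    (periodic_part (cyclic_group g)) (K j) `&` periodic_part (cyclic_group g)) y.
  by rewrite -Vj.
rewrite (cyclic_groupJ Kg gb) -Ka in Kb.
have : stabilizer (cyclic_group g) x (zpow g k) by split=> //; exists k.
by rewrite -Kb => -[].
Qed.

(** A minimal set [W] in the closure of an infinite orbit is itself infinite, since points near a
    finite orbit have finite orbits. It is therefore open, so the orbit of [x] enters it and [x]
    belongs to it. *)
Lemma orbit_dichotomy g G x : compact [set: X] -> hausdorff_space X ->
    minimal_periodic_partition (cyclic_group g) ->
    subgroup G -> finitely_generated G -> G `<=` topological_full_group g ->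
  periodic_part G x \/
  exists W, [/\ clopen W, infinite_set W, minimal G W & W x].
Proof.
move=> cX hX part sG fgG Gfull.
have [m [A [Amin _ _ cov _]]] := part.
have locG : locally_fixing G.
  by move=> h y /Gfull; apply: full_group_locally_fixing.
have bG h : G h -> exists R, bounded_displacement g h R.
  by move=> /Gfull; apply: full_group_bounded.
have [|infGx] := pselect (finite_set (orbit G x)); [by left|right].
have Gg : orbit G x `<=` orbit (cyclic_group g) x.
  by move=> _ [h /Gfull[c [cg _ hc]] <-]; exists (c x).
have : [set: X] x by [].
rewrite -cov => -[[i _ Ax]|per_x]; last first.
  by case: infGx; apply: sub_finite_set Gg per_x.
have [[oA cA] infA mA] := Amin i; have [_ iA _] := mA.
have orbA : orbit G x `<=` A i.
  by apply: subset_trans Gg _; apply: orbit_sub => //; apply: subgroup_cyclic.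
have clA : closure (orbit G x) `<=` A i.
  by rewrite closureE; apply: smallest_sub.
have [W [cW Wcl mW]] := exists_minimal cX sG (@closed_closure _ (orbit G x))
  (closure_orbit_invariant x sG) (ex_intro _ x (subset_closure (orbit_self x sG))).
have [[w Ww] iW _] := mW.
have orbit_meets U : nbhs w U -> exists2 h, G h & U (h x).
  by move=> /(Wcl w Ww)[_ [[h Gh <-] Uh]]; exists h.
have infW : infinite_set W.
  move=> finW; apply: infGx.
  have per_w : periodic_part G w by apply: sub_finite_set (orbit_sub sG iW Ww) finW.
  have near_per := near_stabilizer hX sG fgG locG per_w.
  have [h Gh [_]] := orbit_meets _ near_per.
  by rewrite /periodic_part /= -(@orbit_eq _ G x) //; exists h.
have oW : open W.
  apply: minimal_infinite_open bG _ mA infA cW mW infW _ => //.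
  by exists w; split=> //; apply/clA/Wcl.
exists W; split=> //.
have [h Gh Wh] := orbit_meets W (open_nbhs_nbhs (conj oW Ww)).
rewrite -(homeoVK h x); apply: (group_invariantP _ sG).1 Wh => //.
by have [_ _ GV] := sG; apply: GV.
Qed.

End FullGroup.

Section Partition.
Set Implicit Arguments.
Unset Strict Implicit.
Local Open Scope group_scope.
Context {X : topologicalType} (cX : compact [set: X]) (hX : hausdorff_space X).
Context {g : homeo X} (part : minimal_periodic_partition (cyclic_group g)).
Context {G : set (homeo X)} (sG : subgroup G) (fgG : finitely_generated G).
Context (Gfull : G `<=` topological_full_group g).
Local Notation orbit := (@Defs.orbit _).
Implicit Types (A P W Y : set X).

Let locG : locally_fixing G.
Proof. by move=> h y /Gfull; apply: full_group_locally_fixing. Qed.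

Lemma periodic_part_open : open (periodic_part G).
Proof.
rewrite openE => x /(near_stabilizer hX sG fgG locG).
by apply: filterS => y [].
Qed.

Lemma periodic_part_closed : closed (periodic_part G).
Proof.
rewrite -openC openE => x nper.
have [//|[W [[oW _] infW mW Wx]]] := orbit_dichotomy x cX hX part sG fgG Gfull.
apply: filterS (open_nbhs_nbhs (conj oW Wx)) => y Wy.
exact: minimal_orbit_infinite mW infW Wy.
Qed.

(** Minimal closed sets that meet are equal, so each point has a neighbourhood meeting at most one
    member; compactness gives finiteness. *)
Lemma finite_minimal_family Y : clopen Y ->
  finite_set [set W | [/\ clopen W, infinite_set W, minimal G W & W `<=` Y]].
Proof.
move=> [oY cY].
set F := (X in finite_set X).
(* In this form [Y] can shrink in the induction while the family [F] stays fixed. *)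
have -> : F = [set W | F W /\ W `&` Y !=set0].
  apply/seteqP; split=> [W FW|W []//]; split=> //.
  by have [_ _ [[w Ww] _ _] WY] := FW; exists w; split=> //; apply: WY.
apply: (@compact_local_ind _ Y
  (fun S => finite_set [set W | F W /\ W `&` S !=set0])).
- exact: subclosed_compact cY cX _.
- apply: sub_finite_set (finite_set0 _) => W [_ [x []]]; rewrite /set0 /=; done.
- move=> S T ST; apply: sub_finite_set => W [FW [x [Wx Sx]]]; split=> //.
  by exists x; split=> //; apply: ST.
- move=> S T finS finT; have : finite_set
    ([set W | F W /\ W `&` S !=set0] `|` [set W | F W /\ W `&` T !=set0]).
    by rewrite finite_setU.
  apply: sub_finite_set => W [FW [x [Wx [Sx|Tx]]]]; [left|right];
    by split=> //; exists x.
move=> x Yx.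
have [perx|[W [[oW cW] infW mW Wx]]] := orbit_dichotomy x cX hX part sG fgG Gfull.
  exists (periodic_part G).
    by apply: open_nbhs_nbhs; split=> //; apply: periodic_part_open.
  apply: sub_finite_set (finite_set0 _) => W [[_ infW mW _] [y [Wy pery]]].
  exact: (minimal_orbit_infinite hX sG mW infW Wy).
exists W; first exact: open_nbhs_nbhs.
apply: sub_finite_set (finite_set1 W) => V [[[_ cV] _ mV _] VW].
exact: minimal_eq sG mV mW cV cW VW.
Qed.

(** Serves twice: for the whole space, and for a [G]-minimal [Y] decomposed under smaller groups. *)
Lemma minimal_decomposition Y : clopen Y -> group_invariant G Y ->
  exists (m : nat) (A : 'I_m -> set X),
    [/\ forall i, [/\ clopen (A i), infinite_set (A i), minimal G (A i) &
                      A i `<=` Y],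
        trivIset [set: 'I_m] A &
        forall x, Y x -> periodic_part G x \/ exists i, A i x].
Proof.
move=> cY iY; have [m [A [Ainj AP]]] := finite_set_enum (finite_minimal_family cY).
have Amin i : [/\ clopen (A i), infinite_set (A i), minimal G (A i) & A i `<=` Y].
  by apply/AP; exists i.
exists m, A; split=> // [i j _ _ Aij|x Yx].
  apply: Ainj; have [[_ ci] _ mi _] := Amin i; have [[_ cj] _ mj _] := Amin j.
  exact: minimal_eq sG mi mj ci cj Aij.
have [|[W [[oW cW] infW mW Wx]]] := orbit_dichotomy x cX hX part sG fgG Gfull.
  by left.
right; suff /AP[i Ai] : [/\ clopen W, infinite_set W, minimal G W & W `<=` Y].
  by exists i; rewrite Ai.
split=> //; case: cY => _ cY.
by apply: minimal_sub sG mW cY iY cW _; exists x.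
Qed.

Lemma stabilizer_finite_index x : periodic_part G x ->
  finite_index_subgroup (stabilizer G x) G.
Proof.
move=> perx; have [G1 GM GV] := sG.
have sS : subgroup (stabilizer G x).
  split=> [|a b [Ga ax] [Gb bx]|a [Ga ax]]; first by split.
    by split; [apply: GM|rewrite /= bx].
  by split; [apply: GV|rewrite -[in LHS]ax homeoVK].
split=> // [h []//|].
apply: (finite_cosetsI (f := fun h : homeo X => h x)) sS perx _ => a b Ga Gb e.
by split; [apply: GM (GV _ Ga) Gb|rewrite /= -e homeo_funK].
Qed.

Lemma finite_stabilizers :
  finite_set [set stabilizer G x | x in periodic_part G].
Proof.
apply: locally_constant_finite; first exact: subclosed_compact periodic_part_closed cX _.
move=> x /(near_stabilizer hX sG fgG locG).
by apply: filterS => y [].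
Qed.

Lemma periodic_part_strongly_periodic : strongly_periodic G (periodic_part G).
Proof.
have [G1 GM GV] := sG.
pose part_of K := conj_stabilizer_part G (periodic_part G) K.
have part_eq K L y : part_of K y -> part_of L y -> part_of K = part_of L.
  suff sub K' L' : part_of K' y -> part_of L' y -> part_of K' `<=` part_of L'.
    by move=> Ky Ly; apply/seteqP; split; apply: sub.
  move=> [_ [a Ga ya]] [_ [b Gb yb]] z [perz [c Gc zc]]; split=> //.
  have KL : conj_set K' a = conj_set L' b by rewrite -ya -yb.
  exists (b * a^-1 * c); first by apply: (GM) => //; apply: GM => //; apply: GV.
  have conjM M d e : conj_set M (d * e) = conj_set (conj_set M d) e.
    apply/seteqP; split=> [_ [k Mk <-]|_ [_ [k Mk <-] <-]].
      by exists (k ^ d); [exists k|rewrite conjgM].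
    by exists k => //; rewrite conjgM.
  by rewrite zc !conjM -KL -!conjM mulVKg.
(* Enumerating the distinct sets [part_of K] instead of the stabilizers selects one stabilizer from
   each conjugacy class. *)
have [n [P [Pinj PP]]] := finite_set_enum (finite_image part_of finite_stabilizers).
have /choice[K KP] i : exists K, part_of K = P i /\
    exists2 x, periodic_part G x & K = stabilizer G x.
  have [_ [x perx <-] <-] : [set part_of K | K in
      [set stabilizer G x | x in periodic_part G]] (P i) by apply/PP; exists i.
  by exists (stabilizer G x); split=> //; exists x.
have part_self x : periodic_part G x -> part_of (stabilizer G x) x.
  move=> perx; split=> //; exists 1 => //.
  apply/seteqP; split=> [h Sh|_ [h Sh <-]]; last by rewrite conjg1.
  by exists h; rewrite ?conjg1.
have part_open L : open (part_of L).
  rewrite openE => x [perx [a Ga xa]].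
  apply: filterS (near_stabilizer hX sG fgG locG perx) => y [yx pery].
  by split=> //; exists a; rewrite // yx.
exists n, K; split=> [i j Kij|j|].
- by apply: Pinj; have [<- _] := KP i; have [<- _] := KP j; rewrite Kij.
- by have [_ [x perx ->]] := KP j; apply: stabilizer_finite_index.
split=> [j|i j _ _ [x [ix jx]]|].
- apply: clopen_clopen_in; first by move=> x [].
  split; first exact: part_open.
  change (closed (part_of (K j))).
  (* Parts are open, and those different from this one are disjoint from it; removing them all
     leaves a closed set. *)
  have -> : part_of (K j) = periodic_part G `\`
      \bigcup_(L in [set L | part_of L <> part_of (K j)]) part_of L.
    apply/seteqP; split=> [x Kx|x [perx nx]].
      split; first by have [] := Kx.
      by move=> [L /= neqL Lx]; apply: neqL; apply: part_eq Lx Kx.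
    have Sx := part_self x perx.
    have [e|neq] := pselect (part_of (stabilizer G x) = part_of (K j)).
      by rewrite -/(part_of _) -e.
    by case: nx; exists (stabilizer G x).
  apply: closedI; first exact: periodic_part_closed.
  by apply: open_closedC; apply: bigcup_open => L _.
- apply: Pinj; have [<- _] := KP i; have [<- _] := KP j.
  exact: part_eq ix jx.
apply/seteqP; split=> [x [j _ []]//|x perx].
have [i Pi] : exists i, P i = part_of (stabilizer G x).
  by apply/PP; exists (stabilizer G x) => //; exists x.
by exists i => //; have [e _] := KP i; rewrite -/(part_of _) e Pi; apply: part_self.
Qed.

Lemma full_subgroup_minimal_periodic_partition : minimal_periodic_partition G.
Proof.
have [//||m [A [Amin Atriv Acov]]] := @minimal_decomposition setT.
- exact: clopenT.
- by apply/(group_invariantP _ sG).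
exists m, A; split=> //.
- by move=> i; have [] := Amin i.
- split; first by split; [exact: periodic_part_open|exact: periodic_part_closed].
  exact: periodic_invariant.
- split=> // i; apply/seteqP; split=> // x [Ax perx].
  have [_ infA mA _] := Amin i.
  exact: (minimal_orbit_infinite hX sG mA infA Ax).
- apply/seteqP; split=> // x _; have [perx|[i Ax]] := Acov x I.
    by right.
  by left; exists i.
- exact: periodic_part_strongly_periodic.
Qed.

End Partition.

(** * Abelian groups acting minimally *)

Section QuotientInt.
Set Implicit Arguments.
Unset Strict Implicit.
Local Open Scope group_scope.
Context {gT : groupType}.
Implicit Types (N K : set gT).

(** The image of [phi] consists of the multiples of some nonzero [d], and dividing by [d] makes the
    induced map on cosets bijective. *)
Lemma quotient_isog_intI N K (phi : gT -> int) : subgroup N ->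
    (forall a b, N a -> N b -> phi (a * b) = (phi a + phi b)%R) ->
    (forall a, K a <-> N a /\ phi a = 0%R) ->
    (exists2 a, N a & phi a <> 0%R) ->
  quotient_isog_int N K.
Proof.
move=> sN phiM KP [a0 Na0 phia0]; have [N1 NM NV] := sN.
have phi1 : phi 1 = 0%R by have := phiM 1 1 N1 N1; rewrite mulg1; lia.
have phiV a : N a -> phi a^-1 = (- phi a)%R.
  by move=> Na; have := phiM _ _ Na (NV _ Na); rewrite mulgV phi1; lia.
have sK : subgroup K.
  split=> [|a b /KP[Na a0'] /KP[Nb b0]|a /KP[Na a0']]; apply/KP.
  - by split.
  - by split; [apply: NM|rewrite phiM // a0' b0].
  - by split; [apply: NV|rewrite phiV // a0'].
have nK : normal_subgroup K N.
  split=> // [a /KP[]//|a Na _ [b /KP[Nb b0] <-]]; apply/KP.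
  split; first exact: subgroupJ.
  by rewrite conjgE !phiM ?phiV ?b0 //; [lia|apply: NV|apply: NM].
split=> //.
have [|||d [ad Nad phid] dP] := @int_subgroup_generator (phi @` N).
- by exists 1.
- by move=> _ _ [a Na <-] [b Nb <-]; exists (a * b); [apply: NM|rewrite phiM].
- by move=> _ [a Na <-]; exists a^-1; [apply: NV|rewrite phiV].
have d0 : d <> 0%R.
  move=> d0; apply: phia0; have [|l ->] := dP (phi a0); first by exists a0.
  by rewrite d0 GRing.mul0r.
(* [f] evaluates [phi] at a chosen representative of the coset; [1] is the default on empty sets. *)
pose f (C : set gT) := (phi (xget 1%g C) %/ d)%Z.
have fE a : N a -> phi a = (d * f (left_coset a K))%R.
  move=> Na; rewrite /f.
  have [k /KP[Nk k0] <-] : left_coset a K (xget 1 (left_coset a K)).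
    apply: xgetPex; exists a; exists 1; last by rewrite mulg1.
    by have [] := sK.
  rewrite phiM // k0 GRing.addr0; have [|l ->] := dP (phi a); first by exists a.
  by rewrite mulKz //; apply/eqP.
have dI k l : (d * k = d * l)%R -> k = l by move=> e; nia.
exists f; split; first split.
- by [].
- move=> _ _ /set_mem[a Na <-] /set_mem[b Nb <-] fab.
  apply/(left_coset_eqP _ _ sK)/KP.
  split; first by apply: NM => //; apply: NV.
  by rewrite phiM ?phiV ?fE // ?fab; [lia|apply: NV].
- move=> k _; have NZ : N (zpow ad k) by apply: subgroupZ.
  exists (left_coset (zpow ad k) K); first by exists (zpow ad k).
  apply: dI; rewrite -fE //; elim/int_ind: k {NZ} => [|n IHn|n IHn].
  + by rewrite GRing.mulr0.
  + rewrite -addn1 PoszD zpowS phiM // ?phid ?IHn; first by lia.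
    exact: subgroupZ.
  + have -> : (- n.+1%:Z = - n%:Z + - 1%:Z)%R by lia.
    rewrite zpowD phiM ?IHn; [|exact: subgroupZ..].
    by rewrite (zpowN ad 1) phiV //= phid; lia.
move=> _ _ [a Na <-] [b Nb <-].
have -> : mul_set (left_coset a K) (left_coset b K) = left_coset (a * b) K.
  have [K1 KM KV] := sK.
  apply/seteqP; split=> [_ [_ [k Kk <-] [_ [l Kl <-] <-]]|_ [k Kk <-]].
    exists (k ^ b * l); first by apply: KM => //; apply: normalJ nK Kk Nb.
    by rewrite conjgE !mulgA mulgK.
  exists a; first by exists 1; rewrite ?mulg1.
  by exists (b * k); [exists k|rewrite mulgA].
by apply: dI; rewrite -fE ?phiM ?GRing.mulrDr -?fE //; apply: NM.
Qed.

End QuotientInt.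

(** * Infinite orbits inside a single orbit of [g] *)

Section Pigeonhole.
Set Implicit Arguments.
Unset Strict Implicit.
Local Open Scope group_scope.
Context {X : topologicalType}.
Local Notation orbit := (@Defs.orbit _).
Implicit Types (f g h : homeo X) (G H K : set (homeo X)) (A P W Y : set X).

Lemma zpow_injective_shift g x y : injective (fun k => zpow g k x) ->
  orbit (cyclic_group g) x y -> injective (fun k => zpow g k y).
Proof.
move=> inj [_ [t _ <-] <-] k l /=; rewrite -!zpow_homeoD => /inj.
by move/GRing.addIr.
Qed.

Lemma free_orbit_infinite g x : (forall k, k != 0%R -> zpow g k x <> x) ->
  infinite_set (orbit (cyclic_group g) x).
Proof.
move=> free fin; apply: infinite_nat.
have inj : injective (fun k : nat => zpow g k%:Z x).
  move=> k l kl; apply: contrapT => /eqP neq_kl.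
  have {}kl : zpow g k%:Z x = zpow g l%:Z x := kl.
  apply: (free (k%:Z - l%:Z)%R); first by lia.
  rewrite GRing.addrC zpow_homeoD kl -zpow_homeoD.
  by rewrite (_ : (- l%:Z + l%:Z = 0)%R) //; lia.
have := @inj_card_eq _ _ setT (fun k : nat => zpow g k%:Z x) (in2W inj).
move/eq_finite_set <-.
by apply: sub_finite_set fin => _ [k _ <-]; exists (zpow g (Posz k)) => //; exists (Posz k).
Qed.

Lemma infinite_orbit_zpow_injective g G x : G `<=` topological_full_group g ->
  infinite_set (orbit G x) -> injective (fun k => zpow g k x).
Proof.
move=> Gfull infG k l /= kl; apply: contrapT => /eqP neq_kl; apply: infG.
apply: (@sub_finite_set _ _ (orbit (cyclic_group g) x)).
  by move=> _ [h /Gfull[c [cg _ hc]] <-]; exists (c x).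
apply: (@zpow_fix_finite_orbit _ g (k - l)%R); first by lia.
rewrite GRing.addrC zpow_homeoD kl -zpow_homeoD.
by rewrite (_ : (- l + l = 0)%R) //; lia.
Qed.

(* Each infinite [G]-orbit in a [g]-orbit meets one of two windows of length
   [R], so there are at most [2 R] of them. *)
Lemma orbit_pigeonhole g G : subgroup G -> finitely_generated G ->
    (forall h, G h -> exists R, bounded_displacement g h R) ->
  exists q : nat, forall x (p : nat -> X), injective (fun k => zpow g k x) ->
    (forall i, orbit (cyclic_group g) x (p i)) ->
    (forall i, infinite_set (orbit G (p i))) ->
    exists i j : nat, (i < j <= q)%N /\ orbit G (p i) (p j).
Proof.
move=> sG fgG bG; have [R RP] := orbit_windows sG fgG bG.
exists R.*2 => x p inj_x px inf_p.
have /choice[t tP] i : exists t : int, p i = zpow g t x.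
  by have [_ [t _ <-] <-] := px i; exists t.
(* Beyond distance [L] from [x] lie common windows for all the points [p i] under consideration,
   whatever their offsets [t i]. *)
pose L : int := (\max_(i < R.*2.+1) `|t i|%N).+1.
have tL i : (i < R.*2.+1)%N -> (Posz `|t i|%N < L)%R.
  move=> iR; rewrite /L ltz_nat ltnS.
  exact: (@leq_bigmax _ (fun i : 'I_R.*2.+1 => `|t i|%N) (Ordinal iR)).
(* A direction and a position in the window give [2 R] values for [2 R + 1] indices, so two orbits
   share a point. *)
have /choice[w wP] (i : 'I_R.*2.+1) : exists w : bool * 'I_R,
    orbit G (p i) (zpow g ((if w.1 then 1 else - 1) * (L + (w.2 : nat)%:Z))%R x).
  have [e e1 win] := RP (p i) (zpow_injective_shift inj_x (px i)) (inf_p i).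
  have [n nM pn] := win (L - e * t i)%R
    ltac:(have := tL i (ltn_ord i); case: e1 => ->; lia).
  have nR : (`|(n + e * t i - L)%R|%N < R)%N by case: e1 nM => ->; lia.
  exists (e == 1%R, Ordinal nR) => /=.
  move: pn; rewrite tP -zpow_homeoD.
  rewrite (_ : (e * n + t i)%R = ((if e == 1 then 1 else - 1) *
    (L + `|(n + e * t i - L)%R|%N%:Z))%R) //.
  by case: e1 nM {nR} => -> nM /=; lia.
have /injectivePn[i [j neq_ij wij]] : ~~ injectiveb w.
  apply/negP => /injectiveP/leq_card.
  by rewrite card_prod card_bool !card_ord; lia.
have pij : orbit G (p i) (p j).
  by apply: (orbit_trans sG (wP i)); rewrite wij; apply: (orbit_sym sG (wP j)).
have := ltn_ord i; have := ltn_ord j => jR iR.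
have [ij|ij] : (i < j)%N \/ (j < i)%N.
- by move: neq_ij; rewrite -val_eqE /=; lia.
- by exists i, j; split=> //; lia.
- by exists j, i; split; [lia|apply: orbit_sym].
Qed.

End Pigeonhole.

Section AbelianAction.
Set Implicit Arguments.
Unset Strict Implicit.
Local Open Scope group_scope.
Context {X : topologicalType} (cX : compact [set: X]) (hX : hausdorff_space X).
Context {g : homeo X}.
Local Notation orbit := (@Defs.orbit _).
Implicit Types (h : homeo X) (G H K N Z : set (homeo X)) (A P W Y : set X).

(** Only the action on [Y] is commutative; the group [Z] itself may fail to be abelian. *)
Definition commute_on Z Y :=
  forall a b y, Z a -> Z b -> Y y -> a (b y) = b (a y).

(** The coincidence set of [a] and [b] in [W] is closed, and invariant because both commute with
    [Z]. For [b = 1] this says that the action is free modulo its kernel. *)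
Lemma commute_on_minimal_agree Z W a b x : subgroup Z -> closed W ->
    minimal Z W -> commute_on Z W -> Z a -> Z b -> W x -> a x = b x ->
  forall y, W y -> a y = b y.
Proof.
move=> sZ cW mW comW Za Zb Wx ab.
have [_ iW minW] := mW; have {}iW := (group_invariantP W sZ).1 iW.
pose F := [set y | a y = b y].
have cF : closed F.
  rewrite -openC openE => y neq_ab.
  have : \forall z \near y, (b^-1 * a) z <> z.
    apply: homeo_near_neq => //= e; apply: neq_ab.
    by rewrite /F /=; have := congr1 b e; rewrite homeo_invK.
  by apply: filterS => z neq e; apply: neq; rewrite /= e homeo_funK.
have [|F0|FW] := minW (W `&` F) (closedI cW cF) (@subIsetl _ _ _).
- apply/group_invariantP => // h Zh y [Wy Fy]; split; first exact: iW.
  by rewrite /F /= !(comW _ h) //; congr (_ _).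
- by have : (W `&` F) x by []; rewrite F0.
by move=> y; rewrite -FW => -[].
Qed.

(** One generator [a] is added at a time: the union of the [a]-orbits of points of [S] remains
    stable under the earlier generators, which commute with [a] on [W]. *)
Lemma torsion_finite_orbit Z W (s : seq (homeo X)) x : subgroup Z ->
    group_invariant Z W -> commute_on Z W -> (forall h, List.In h s -> Z h) ->
    (forall h y, List.In h s -> W y -> finite_set (orbit (cyclic_group h) y)) ->
    W x ->
  exists S : set X, [/\ finite_set S, S x, S `<=` W &
    forall h, List.In h s -> forall y, S y -> S (h y) /\ S (h^-1 y)].
Proof.
move=> sZ /(group_invariantP _ sZ) iW comW; have [_ _ ZV] := sZ.
elim: s => [_ _ Wx|a s IHs sZa tors Wx].
  by exists [set x]; split=> // _ ->.
have Za : Z a by apply: sZa; left.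
have [||//|S [finS Sx SW Sst]] := IHs.
- by move=> h sh; apply: sZa; right.
- by move=> h y sh; apply: tors; right.
have sa := subgroup_cyclic a.
exists (\bigcup_(y in S) orbit (cyclic_group a) y); split.
- by apply: bigcup_finite => // y /SW; apply: tors; left.
- by exists x => //; apply: orbit_self.
- by move=> _ [y /SW Wy [_ [k _ <-] <-]]; apply: iW => //; apply: subgroupZ.
have orb_h h y z : Z h -> S y -> S (h y) -> orbit (cyclic_group a) y z ->
    (\bigcup_(y in S) orbit (cyclic_group a) y) (h z).
  move=> Zh Sy Shy [_ [k _ <-] <-]; exists (h y) => //.
  exists (zpow a k); first by exists k.
  by apply: comW; [apply: subgroupZ|..|apply: SW].
move=> h [<-|sh] z [y Sy yz].
  have ca : cyclic_group a a by exists 1%R.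
  split; exists y => //; first exact: orbitM.
  by apply: orbitM => //; have [_ _] := sa; apply.
have Zh : Z h by apply: sZa; right.
have [Shy Shy'] := Sst h sh y Sy.
by split; [apply: orb_h yz|apply: orb_h yz => //; apply: ZV].
Qed.


(** If all generators had finite orbits, so would [Z]; hence some generator [z0] has infinite ones.
    The points [(z ^+ i) x] lie in one [g]-orbit, so two of them share a [z0]-orbit, and a power of
    [z] agrees with a power of [z0] at one point, hence on [W]. The bound [q] is uniform in [z]. *)
Lemma abelian_minimal_virtually_cyclic Z W : subgroup Z ->
    finitely_generated Z -> Z `<=` topological_full_group g ->
    closed W -> minimal Z W -> infinite_set W -> commute_on Z W ->
  exists2 z0, Z z0 & (forall y, W y -> infinite_set (orbit (cyclic_group z0) y)) /\
    exists q, forall z, Z z -> exists2 m, (0 < m <= q)%N &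
      exists k : int, forall y, W y -> (z ^+ m) y = zpow z0 k y.
Proof.
move=> sZ [s sZ' gen] Zfull cW mW infW comW.
have [[x Wx] iW0 _] := mW; have iW := (group_invariantP W sZ).1 iW0.
have infZ y : W y -> infinite_set (orbit Z y).
  exact: minimal_orbit_infinite.
have agree := commute_on_minimal_agree sZ cW mW comW.
have [Z1 ZM ZV] := sZ.
have [z0 Zz0 inf_z0] : exists2 z0, Z z0 &
    forall y, W y -> infinite_set (orbit (cyclic_group z0) y).
  apply: contrapT => no_z0.
  have tors h y : List.In h s -> W y -> finite_set (orbit (cyclic_group h) y).
    move=> sh Wy; have Zh := sZ' h sh; apply: contrapT => inf_y.
    apply: no_z0; exists h => // z Wz; apply: free_orbit_infinite => k k0 fix_z.
    apply: inf_y; apply: zpow_fix_finite_orbit k0 _.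
    (* A power of [h] that fixes one point of [W] acts trivially on [W], in particular at [y]. *)
    by apply: (agree _ 1 z) => //; apply: subgroupZ.
  have [S [finS Sx _ Sst]] :=
    torsion_finite_orbit sZ iW0 comW sZ' tors Wx.
  apply: (infZ x Wx); apply: sub_finite_set finS => _ [h Zh <-].
  exact: (fg_stable sZ gen Sst).
exists z0 => //; split=> //.
have sz0 := subgroup_cyclic z0.
have z0Z : cyclic_group z0 `<=` Z by move=> _ [k _ <-]; apply: subgroupZ.
have [q qP] := orbit_pigeonhole sz0 (fg_cyclic z0)
  (fun h zh => full_group_bounded cX (Zfull h (z0Z h zh))).
exists q => z Zz; have WX i : W ((z ^+ i) x) by apply: iW => //; apply: subgroupX.
have orb_g i : orbit (cyclic_group g) x ((z ^+ i) x).
  have /Zfull[c [cg _ ->]] : Z (z ^+ i) by apply: subgroupX.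
  by exists (c x).
have [i [j [ij [_ [k _ <-] e]]]] := qP x (fun i => (z ^+ i) x)
  (infinite_orbit_zpow_injective Zfull (infZ x Wx)) orb_g
  (fun i => inf_z0 _ (WX i)).
exists (j - i)%N; first by lia.
exists k; apply: (agree _ _ ((z ^+ i) x)) => //; first exact: subgroupX.
  exact: subgroupZ.
rewrite e -[LHS]/((z ^+ (j - i) * z ^+ i) x) -expgnDr subnK //; lia.
Qed.

Lemma commute_onX Z Y a b y n : subgroup Z -> group_invariant Z Y ->
    commute_on Z Y -> Z a -> Z b -> Y y ->
  ((a * b) ^+ n) y = (a ^+ n) ((b ^+ n) y).
Proof.
move=> sZ /(group_invariantP _ sZ) iY comY Za Zb Yy.
elim: n => // n IHn; rewrite !expgS /= IHn.
rewrite (comY b (a ^+ n)) //; first exact: subgroupX.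
by apply: iY => //; apply: subgroupX.
Qed.

Lemma abelian_normal_case G Z Y : minimal_periodic_partition (cyclic_group g) ->
    G `<=` topological_full_group g ->
    (forall H, subgroup H -> H `<=` G -> finitely_generated H) ->
    normal_subgroup Z G -> clopen Y -> group_invariant G Y -> commute_on Z Y ->
    (forall y, Y y -> infinite_set (orbit Z y)) ->
  exists (N : set (homeo X)) (n : nat) (B : 'I_n -> set X),
    [/\ normal_subgroup N G, clopen_partition_in Y B,
        forall i, minimal N (B i) &
        forall i, quotient_isog_int N (pointwise_stabilizer N (B i))].
Proof.
move=> part Gfull fgG nZ clY iGY comY infY.
have [sZ sG ZG _] := nZ; have [Z1 ZM ZV] := sZ; have [G1 GM GV] := sG.
have Zfull := subset_trans ZG Gfull.
have fgZ := fgG Z sZ ZG; have iZY := group_invariantS ZG iGY.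
have iGY' := (group_invariantP Y sG).1 iGY.
have [m [A [Amin _ Acov]]] :=
  minimal_decomposition cX hX part sZ fgZ Zfull clY iZY.
have {}Acov y : Y y -> exists i, A i y.
  by move=> Yy; have [per|//] := Acov y Yy; case: (infY y Yy).
have comA i : commute_on Z (A i).
  by move=> a b y Za Zb Ay; apply: comY => //; have [_ _ _] := Amin i; apply.
have /choice[z0 z0P] (i : 'I_m) : exists z0, Z z0 /\
    (forall y, A i y -> infinite_set (orbit (cyclic_group z0) y)) /\
    exists q, forall z, Z z -> exists2 r, (0 < r <= q)%N &
      exists k : int, forall y, A i y -> (z ^+ r) y = zpow z0 k y.
  have [[_ cA] infA mA _] := Amin i.
  have [z Zz zP] := abelian_minimal_virtually_cyclic sZ fgZ Zfull cA mA infA (comA i).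
  by exists z.
have /choice[q qP] (i : 'I_m) : exists q, forall z, Z z ->
    exists2 r, (0 < r <= q)%N &
      exists k : int, forall y, A i y -> (z ^+ r) y = zpow (z0 i) k y.
  by have [_ [_]] := z0P i.
(* The factorial is divisible by every exponent [r] that occurs, on every piece [A i]. *)
pose M := ((\max_i q i)`!)%N.
have M0 : (0 < M)%N by apply: fact_gt0.
have zM i z : Z z ->
    exists k : int, forall y, A i y -> (z ^+ M) y = zpow (z0 i) k y.
  move=> Zz; have [r /andP[r0 rq] [k kP]] := qP i z Zz.
  have /dvdnP[t Mt] : (r %| M)%N.
    by apply: dvdn_fact; rewrite r0 (leq_trans rq) //; apply: leq_bigmax.
  exists (k * t%:Z)%R => y Ay; rewrite Mt mulnC expgnA zpowM.
  have [_ _ mA _] := Amin i; have [_ /(group_invariantP _ sZ) iA _] := mA.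
  elim: t {Mt} => // t IHt; rewrite expgS /= IHt.
  rewrite kP /= ?expgS //; apply: (iA) => //.
  have [Zz0 _] := z0P i.
  by apply: subgroupX => //; apply: subgroupZ.
(* Being an [M]-th power is required only of the action on [Y], where [Z] commutes and such powers
   are closed under products. Conjugates of powers are powers, so [N] is normal in [G]. *)
pose N : set (homeo X) := [set n | Z n /\ exists2 w, Z w &
  forall y, Y y -> n y = (w ^+ M) y].
have sN : subgroup N.
  split=> [|a b [Za [u Zu ua]] [Zb [v Zv vb]]|a [Za [u Zu ua]]].
  - by split=> //; exists 1 => // y _; rewrite expg1n.
  - split; first exact: ZM.
    exists (u * v) => [|y Yy]; first exact: ZM.
    rewrite (commute_onX M sZ iZY comY Zu Zv Yy) /= vb // ua //.
    by apply: iGY' => //; apply: ZG; apply: subgroupX.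
  - split; first exact: ZV.
    exists u^-1 => [|y Yy]; first exact: ZV.
    have uMy : Y ((u^-1 ^+ M) y).
      by apply: iGY' => //; apply: ZG; apply: subgroupX => //; apply: ZV.
    by apply: (@homeo_inj _ a); rewrite homeoKV ua // expVgn homeoKV.
have NZ : N `<=` Z by move=> n [].
have NG := subset_trans NZ ZG.
have nN : normal_subgroup N G.
  split=> // a Ga _ [n [Zn [w Zw nw]] <-].
  split; first exact: normalJ nZ Zn Ga.
  exists (w ^ a) => [|y Yy]; first exact: normalJ nZ Zw Ga.
  by rewrite -conjXg !conjgE /= nw //; apply: iGY'.
have Nfull := subset_trans NG Gfull.
have fgN := fgG N sN NG; have iNY := group_invariantS NG iGY.
have z0MN i : N (z0 i ^+ M).
  have [Zz0 _] := z0P i; split; first exact: subgroupX.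
  by exists (z0 i).
have free i y k : A i y -> k != 0%R -> zpow (z0 i) k y <> y.
  move=> Ay k0 fix_y; have [_ [/(_ y Ay) infz _]] := z0P i.
  exact/infz/zpow_fix_finite_orbit/fix_y.
have infN y : Y y -> infinite_set (orbit N y).
  move=> Yy finN; have [i Ay] := Acov y Yy.
  apply: (@free_orbit_infinite _ (z0 i ^+ M) y).
    move=> k k0; rewrite -[z0 i ^+ M]/(zpow (z0 i) M) -zpowM.
    by apply: free => //; lia.
  apply: sub_finite_set finN; apply: orbitS => _ [k _ <-].
  exact: subgroupZ.
have [n [B [Bmin Btriv Bcov]]] :=
  minimal_decomposition cX hX part sN fgN Nfull clY iNY.
have {}Bcov y : Y y -> exists i, B i y.
  by move=> Yy; have [per|//] := Bcov y Yy; case: (infN y Yy).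
exists N, n, B; split=> //.
- split=> // [i|]; first by have [clB _ _ BY] := Bmin i; apply: clopen_clopen_in.
  apply/seteqP; split=> [y [i _]|y Yy]; first by have [_ _ _] := Bmin i; apply.
  by have [i Bi] := Bcov y Yy; exists i.
- by move=> i; have [] := Bmin i.
move=> j; have [[_ cB] _ mB BY] := Bmin j; have [[x Bx] iB0 _] := mB.
have [i Ax] := Acov x (BY x Bx); have [[_ cA] _ [_ iA _] _] := Amin i.
(* Each [N]-minimal piece lies in one [Z]-minimal piece, where elements of [N] act as powers of
   [z0 i]. *)
have BA : B j `<=` A i.
  apply: minimal_sub sN mB cA (group_invariantS NZ iA) cB _.
  by exists x.
(* The exponent is unique because [z0 i] acts freely, which makes [phi] additive on [N]; its value
   outside [N] is arbitrary. *)
have /choice[phi phiP] h : exists k : int, N h ->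
    forall y, B j y -> h y = zpow (z0 i) k y.
  have [[Zh [w Zw hw]]|nN'] := pselect (N h); last by exists 0%R.
  have [k kP] := zM i w Zw; exists k => _ y By.
  by rewrite hw ?kP //; [apply: BA|apply: BY].
have phi_uniq h k y : N h -> B j y -> h y = zpow (z0 i) k y -> phi h = k.
  move=> Nh By e; apply: contrapT => /eqP neq_k.
  apply: (free i y (- k + phi h)%R (BA y By)); first by lia.
  rewrite zpow_homeoD -phiP // e -zpow_homeoD GRing.addNr //.
have iB := (group_invariantP (B j) sN).1 iB0.
apply: (quotient_isog_intI (phi := phi)) => //.
- move=> a b Na Nb; apply: (phi_uniq _ _ x) => //.
    by have [_ NM _] := sN; apply: NM.
  by rewrite zpow_homeoD -(phiP b) // -(phiP a) //; apply: iB.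
- move=> a; split=> [[Na ax]|[Na a0]]; split=> //.
    by apply: (phi_uniq _ _ x) => //; rewrite ax.
  by move=> y By; rewrite phiP // a0.
- exists (z0 i ^+ M) => //.
  rewrite (phi_uniq _ (Posz M) x) //; lia.
Qed.

End AbelianAction.

(** * Virtually polycyclic groups *)

Section SolvableCase.
Set Implicit Arguments.
Unset Strict Implicit.
Local Open Scope group_scope.
Context {X : topologicalType} (cX : compact [set: X]) (hX : hausdorff_space X).
Context {g : homeo X} (part : minimal_periodic_partition (cyclic_group g)).
Local Notation orbit := (@Defs.orbit _).
Implicit Types (h : homeo X) (A B G H K N Z : set (homeo X)) (P W Y : set X).

Lemma finite_index_periodic K H : finite_index_subgroup K H ->
  periodic_part K `<=` periodic_part H.
Proof.
move=> [sK sH KH fin] x perx.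
have [s _ sP] := finite_cosets_transversal sK fin.
apply: (@sub_finite_set _ _ (\bigcup_(t in [set t | List.In t s]) t @` orbit K x)).
  move=> _ [h Hh <-]; have [t st Kth] := sP h Hh.
  exists t => //; exists ((t^-1 * h) x); first by exists (t^-1 * h).
  by rewrite /= homeo_invK.
apply: bigcup_finite => [|t _]; last exact: finite_image.
elim: s {sP} => [|t s IHs]; first by apply: sub_finite_set (finite_set0 _).
apply: (@sub_finite_set _ _ ([set t] `|` [set t | List.In t s])).
  by move=> u [<-|]; [left|right].
by rewrite finite_setU; split.
Qed.

Lemma normal_periodic_invariant H G : normal_subgroup H G ->
  group_invariant G (periodic_part H).
Proof.
move=> nH; have [sH sG HG _] := nH; apply/group_invariantP => // a Ga y.
move=> /(finite_image a); apply: sub_finite_set => _ [h Hh <-].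
exists ((h ^ a) y); first by exists (h ^ a) => //; apply: normalJ nH Hh Ga.
by rewrite conjgE /= homeo_invK.
Qed.

(** Extension by the identity outside [Y] turns equality of actions on [Y] into equality of
    functions. *)
Definition restriction Y h : X -> X := fun y => if pselect (Y y) then h y else y.

Lemma restriction_eqP Y h h' :
  restriction Y h = restriction Y h' <-> forall y, Y y -> h y = h' y.
Proof.
split=> [e y Yy|e]; last first.
  by apply: funext => y; rewrite /restriction; case: pselect => // Yy; apply: e.
by have := congr1 (@^~ y) e; rewrite /restriction; case: pselect.
Qed.

(** Points with finite orbits have only finitely many stabilizers, each of finite index; the cosets
    of [h] modulo these determine [h] on [Y]. *)
Lemma finite_restrictions B Y : subgroup B -> finitely_generated B ->
    B `<=` topological_full_group g -> Y `<=` periodic_part B ->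
  finite_set (restriction Y @` B).
Proof.
move=> sB fgB Bfull Yper; have [_ BM BV] := sB.
have [s sP] := finite_set_List (finite_stabilizers cX hX part sB fgB Bfull).
have fin : finite_set ((fun h => [seq left_coset h K | K <- s]) @` B).
  apply: (@finite_image_tuple _ _ _ B s (fun K h => left_coset h K)).
  move=> K /sP[x perx <-]; have [_ _ _] := stabilizer_finite_index sB perx.
  exact.
apply: finite_image_factor fin _ => a b Ba Bb.
move=> /(@eq_map_In _ _ _ s (fun K h => left_coset h K)) e.
apply/restriction_eqP => y Yy; have pery := Yper y Yy.
have [sS _ _ _] := stabilizer_finite_index sB pery.
have /(left_coset_eqP _ _ sS)[_] := e (stabilizer B y) ((sP _).1 (ex_intro2 _ _ y pery erefl)).
by move=> /(congr1 a); rewrite /= homeo_invK => ->.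
Qed.

(** For [A]-invariant [Y], the preimage in [A] of the centre of the group that [A] induces on
    [Y]. *)
Definition centre_on A Y : set (homeo X) :=
  [set a | A a /\ forall b y, A b -> Y y -> a (b y) = b (a y)].

Lemma centre_on_normal A G Y : normal_subgroup A G -> group_invariant G Y ->
  normal_subgroup (centre_on A Y) G.
Proof.
move=> nA iY; have [sA sG AG _] := nA; have [A1 AM AV] := sA.
have [_ _ GV] := sG; have {}iY := (group_invariantP Y sG).1 iY.
split=> // [|a [/AG]//|c Gc _ [a [Aa aP] <-]].
  split=> [|a b [Aa aP] [Ab bP]|a [Aa aP]]; first by split.
    split=> [|c y Ac Yy] /=; first exact: AM.
    by rewrite bP // aP //; apply: iY => //; apply: AG.
  split=> [|c y Ac Yy]; first exact: AV.
  apply: (@homeo_inj _ a); rewrite homeoKV aP ?homeoKV //.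
  by apply: iY => //; apply/AG/AV.
split=> [|b y Ab Yy]; first exact: normalJ nA Aa Gc.
have Abc : A (b ^ c^-1) by apply: normalJ nA Ab (GV _ Gc).
have e : forall z, (b ^ c^-1) (c z) = c (b z).
  by move=> z; rewrite conjgE invgK /= homeo_funK.
apply: (@homeo_inj _ c); rewrite -!e (conjgE a) /= !homeo_invK -e.
by rewrite aP //; apply: iY.
Qed.

(* [a |-> a s a^-1 s^-1] takes finitely many values on [Y] and separates the
   cosets of the centralizer of [s]. *)
Lemma centre_on_finite_index A G Y : normal_subgroup A G ->
    finitely_generated A -> finitely_generated (derived_group A) ->
    A `<=` topological_full_group g -> group_invariant G Y ->
    Y `<=` periodic_part (derived_group A) ->
  finite_index_subgroup (centre_on A Y) A.
Proof.
move=> nA [s sA' gen] fgD Afull iGY Yper; have [sA sG AG _] := nA.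
have [A1 AM AV] := sA.
have [sC _ _ _] := centre_on_normal nA iGY.
have iY := (group_invariantP Y sA).1 (group_invariantS AG iGY).
split=> // [a []//|].
pose f t a := restriction Y [~ a^-1, t^-1].
have fin : finite_set ((fun a => [seq f t a | t <- s]) @` A).
  apply: (@finite_image_tuple _ _ _ A s f) => t st.
  apply: sub_finite_set (finite_restrictions (derived_group_subgroup A) fgD
    (subset_trans (derived_group_sub sA) Afull) Yper).
  move=> _ [a Aa <-]; exists [~ a^-1, t^-1] => //.
  by apply: derived_groupR; apply: AV => //; apply: sA'.
apply: (finite_cosetsI sC fin) => a b Aa Ab /(@eq_map_In _ _ _ s f) e.
split; first by apply: AM => //; apply: AV.
have comm t y : List.In t s -> Y y -> (a^-1 * b) (t y) = t ((a^-1 * b) y).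
  move=> st Yy; have At := sA' t st.
  (* At the point [t (b y)] the commutator formed with [b] reduces to [b (t y)], and the one with
     [a] to [a (t (a^-1 (b y)))]. *)
  have Yz : Y (t (b y)) by apply: (iY) => //; apply: iY.
  have /restriction_eqP/(_ _ Yz) := e t st.
  rewrite !commgEl !conjgE !invgK /= !homeo_funK => ab.
  by apply: (@homeo_inj _ a); rewrite /= homeo_invK -ab.
move=> c y Ac; move: y; pose K := [set h | A h /\
  forall y, Y y -> (a^-1 * b) (h y) = h ((a^-1 * b) y)].
have Aab : A (a^-1 * b) by apply: AM => //; apply: AV.
suff [_ Kc] : K c by move=> y; apply: Kc.
apply: gen Ac => [|t st]; last by split; [apply: sA'|move=> y; apply: comm].
split=> [|u v [Au Ku] [Av Kv]|u [Au Ku]]; first by split.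
  split=> [|y Yy]; first exact: AM.
  by rewrite [(u * v) y]/(u (v y)) Ku ?Kv //; apply: iY.
split=> [|y Yy]; first exact: AV.
apply: (@homeo_inj _ u); rewrite homeoKV -Ku ?homeoKV //.
by apply: iY => //; apply: AV.
Qed.

Lemma virtually_polycyclic_minimal G Y : virtually_polycyclic G ->
    subgroup G -> G `<=` topological_full_group g ->
    clopen Y -> minimal G Y -> infinite_set Y ->
  exists (N : set (homeo X)) (n : nat) (B : 'I_n -> set X),
    [/\ normal_subgroup N G, clopen_partition_in Y B,
        forall i, minimal N (B i) &
        forall i, quotient_isog_int N (pointwise_stabilizer N (B i))].
Proof.
move=> vpc sG Gfull [oY cY] mY infY.
have fgG H : subgroup H -> H `<=` G -> finitely_generated H.
  exact: fg_sub_virtually_polycyclic.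
have [[y0 Yy0] iY minY] := mY.
have [K fiK pK] := vpc.
pose D i := iter i derived_group (normal_core K G).
have nD i : normal_subgroup (D i) G.
  exact/iter_derived_normal/normal_core_normal.
have [r rP] := polycyclic_derived pK.
have core_K : normal_core K G `<=` K.
  by move=> x [_ /(_ 1)]; rewrite conjg1; apply; have [] := sG.
have ex : exists i, `[< Y `<=` periodic_part (D i) >].
  exists r; apply/asboolP => y _; apply: sub_finite_set (finite_set1 y) => _ [h Dh <-].
  by have /rP -> := iter_derivedS core_K Dh.
have [i /asboolP perD i_min] := ex_minnP ex.
have fiC := normal_core_finite_index fiK.
(* The index is positive: the core has finite index in [G], so finite orbits under it would make the
   orbits of [G] finite. *)
case: i perD i_min => [perD _|i perD i_min].
  case: (minimal_orbit_infinite hX sG mY infY Yy0).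
  exact/(finite_index_periodic fiC)/perD.
have [sA _ AG _] := nD i.
have fgA := fgG _ sA AG; have Afull := subset_trans AG Gfull.
have infA y : Y y -> infinite_set (orbit (D i) y).
  (* The periodic part of [D i] is closed and [G]-invariant, so it misses [Y] or contains it; the
     latter contradicts the choice of the least index. *)
  have [e|e] : Y `&` periodic_part (D i) = set0 \/ Y `&` periodic_part (D i) = Y.
  - apply: minY; [|by move=> x []|].
      exact: closedI cY (periodic_part_closed cX hX part sA fgA Afull).
    exact: group_invariantI (normal_periodic_invariant (nD i)).
  - by move=> Yy fin; have : (Y `&` periodic_part (D i)) y by []; rewrite e.
  - suff /i_min : `[< Y `<=` periodic_part (D i) >] by lia.
    by apply/asboolP; rewrite -e; apply: subIsetr.
have fiZ : finite_index_subgroup (centre_on (D i) Y) (D i).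
  apply: centre_on_finite_index (nD i) _ _ _ iY perD => //.
  by have [sD _ DG _] := nD i.+1; apply: fgG.
have nZ := centre_on_normal (nD i) iY.
have comZ : commute_on (centre_on (D i) Y) Y.
  by move=> a b y [Aa aP] [Ab _] Yy; apply: aP.
have infZ y : Y y -> infinite_set (orbit (centre_on (D i) Y) y).
  by move=> Yy /(finite_index_periodic fiZ); apply: infA.
exact: abelian_normal_case part Gfull fgG nZ (conj oY cY) iY comZ infZ.
Qed.

Lemma finite_minimal G Y : subgroup G -> finite_set Y ->
  exists (N : set (homeo X)) (n : nat) (B : 'I_n -> set X),
    [/\ normal_subgroup N G, clopen_partition_in Y B &
        forall i, minimal N (B i)].
Proof.
move=> sG finY; have [G1 _ _] := sG.
have [n [F [Finj FP]]] := finite_set_enum finY.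
exists [set 1], n, (fun i => [set F i]); split.
- split=> //; [exact: subgroup1|by move=> _ ->|].
  by move=> a Ga _ [_ -> <-]; rewrite conj1g.
- split=> [i|i j _ _ [x [/= -> /Finj]]//|].
    by apply: finite_clopen_in => // _ ->; apply/FP; exists i.
  apply/seteqP; split=> [x [i _ ->]|x /FP[i <-]]; first by apply/FP; exists i.
  by exists i.
move=> i; split; first by exists (F i).
  by apply/(group_invariantP _ subgroup1) => _ -> y ->.
move=> C _ CF _; have [CFi|nCF] := pselect (C (F i)); [right|left].
  by apply/seteqP; split=> // _ ->.
by apply/seteqP; split=> // x Cx; apply: nCF; rewrite -(CF x Cx).
Qed.

End SolvableCase.

Theorem theorem1p4 (X : topologicalType)
    (Xinf : infinite_set [set: X]) (Xcpt : compact [set: X])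
    (XT2 : hausdorff_space X)
    (g : homeo X) (G : set (homeo X))
    (Gsub : subgroup G) (Gfull : G `<=` topological_full_group g)
    (Gvpc : virtually_polycyclic G) :
  (minimal_periodic_partition (cyclic_group g) ->
   minimal_periodic_partition G) /\
  (minimal_periodic_partition (cyclic_group g) ->
   forall Y : set X, closed Y -> minimal G Y ->
   exists (N : set (homeo X)) (n : nat) (Z : 'I_n -> set X),
     [/\ normal_subgroup N G,
         clopen_partition_in Y Z,
         forall i, minimal N (Z i) &
         infinite_set Y ->
         forall i, quotient_isog_int N (pointwise_stabilizer N (Z i))]).
Proof.
have fgG : finitely_generated G by apply: fg_sub_virtually_polycyclic Gvpc _ _.
split=> [part|part Y cY mY].
  exact: (full_subgroup_minimal_periodic_partition Xcpt XT2 part Gsub fgG Gfull).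
have [finY|infY] := pselect (finite_set Y).
  have [N [n [B [nN clB mB]]]] := finite_minimal XT2 Gsub finY.
  by exists N, n, B; split.
have [[y Yy] iY _] := mY.
(* An infinite closed minimal set coincides with the clopen one found at any of its points, hence is
   open. *)
have [pery|[W [[oW cW] _ mW Wy]]] := orbit_dichotomy y Xcpt XT2 part Gsub fgG Gfull.
  by case: (minimal_orbit_infinite XT2 Gsub mY infY Yy).
have WY : W = Y by apply: minimal_eq Gsub mW mY cW cY _; exists y.
rewrite WY in oW.
have [N [n [B [nN clB mB qB]]]] := virtually_polycyclic_minimal
  Xcpt XT2 part Gvpc Gsub Gfull (conj oW cY) mY infY.
by exists N, n, B; split.
Qed.
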